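(* Let $\mathcal{H}\subset\mathbb{M}_{M,N}$ be a linear subspace, let $\mathcal{V}$ be a Euclidean space, let $\mathfrak{M}:\mathcal{H}\to\mathcal{V}$ be a linear operator, let $h\in\mathcal{V}$, $\tau>0$ and $1<q<\infty$. Assume that $\mathfrak{M}^*\mathfrak{M}\le I$, where $I$ is the identity operator on $\mathcal{H}$. Let $A^{\circ}\in\mathcal{H}$. Then there exists $W^{\circ}\in\mathbb{M}_{M,N}$ such that $(W^{\circ},A^{\circ})$ is a fixed point of $\mathfrak{B}^{\mathfrak{M}}_{h,\tau,q}$ if and only if $A^{\circ}$ is a stationary point of the objective functional $$A\mapsto \mathcal{R}_{\tau}(A)+q\,\|\mathfrak{M}A-h\|_{\mathcal{V}}^2$$ considered as a functional on $\mathcal{H}$. This objective functional is convex if $q\mathfrak{M}^*\mathfrak{M}\ge I$, and strictly convex if $q\mathfrak{M}^*\mathfrak{M}>I$.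
   Context: $\mathbb{M}_{M,N}$ is the Euclidean space of $M\times N$ matrices (real or complex) with the Frobenius norm $\|\cdot\|$; $\sigma_j(A)$ denotes the singular values of $A$. For $\tau>0$, $$\mathcal{R}_{\tau}(A)=\sum_j\left(\tau^2-\big(\max(\tau-\sigma_j(A),0)\big)^2\right).$$ $\mathcal{P}_{\mathcal{H}}$ and $\mathcal{P}_{\mathcal{H}^\perp}$ are the orthogonal projections onto $\mathcal{H}$ and its orthogonal complement. Operator inequalities are in the sense of self-adjoint operators on $\mathcal{H}$. Singular value functional calculus: for a real-valued $f$ on $[0,\infty)$ with $f(0)=0$ and $A=U\,\mathrm{diag}(\{\sigma_j(A)\})V^*$ a singular value decomposition, $\mathfrak{S}_f(A)=U\,\mathrm{diag}(\{f(\sigma_j(A))\})V^*$. Set $s_{\tau,q}(\sigma)=\max\left(\min(\sigma,\tau),\frac{\sigma}{q}\right)$. The operator $(W',A')=\mathfrak{B}^{\mathfrak{M}}_{h,\tau,q}(W,A)$, for $W\in\mathbb{M}_{M,N}$ and $A\in\mathcal{H}$, is defined by $$W'=\mathfrak{S}_{s_{\tau,q}}\Big(q\big(\mathfrak{M}^*(h-\mathfrak{M}A)+A\big)+\mathcal{P}_{\mathcal{H}^\perp}(W)\Big),$$ $$A'=\frac{1}{q-1}\Big(q\big(\mathfrak{M}^*(h-\mathfrak{M}A)+A\big)-\mathcal{P}_{\mathcal{H}}(W')\Big).$$ The function $\mathcal{R}_\tau(A)+\|A\|^2$ is convex, so the objective functional is a convex function plus a (smooth) quadratic polynomial; a stationary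 point is a point at which $0$ belongs to its subdifferential (the convex subdifferential of the convex part plus the gradient of the smooth part), as a functional on $\mathcal{H}$ viewed as a real Euclidean space. *)

(* Defs.v *)
From HB Require Import structures.
From mathcomp Require Import all_boot all_order all_algebra.
From mathcomp Require Import complex.
From mathcomp Require Import boolp classical_sets interval_inference reals convex.

Set Implicit Arguments.
Unset Strict Implicit.
Unset Printing Implicit Defensive.

Import Order.TTheory GRing.Theory Num.Theory.

Local Open Scope ring_scope.
Local Open Scope sesquilinear_scope.
Local Open Scope classical_set_scope.
Local Open Scope convex_scope.

(* The matrices are either real or complex; the base field is [R] or [R[i]],
   selected by a tag, so that one statement covers both settings. *)
Variant field_kind := RealField | ComplexField.

Definition base_field (R : realType) (k : field_kind) : numFieldType :=
  match k with
  | RealField => R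
  | ComplexField => R[i]
  end.

Definition sconj (R : realType) (k : field_kind) :
    involutive_rmorphism (base_field R k) :=
  match k with
  | RealField => @idfun R
  | ComplexField => @Num.conj R[i]
  end.

Definition of_real (R : realType) (k : field_kind) :
    {rmorphism R -> base_field R k} :=
  match k with
  | RealField => @idfun R
  | ComplexField => real_complex R
  end.

Definition real_part (R : realType) (k : field_kind) : base_field R k -> R :=
  match k with
  | RealField => @idfun R
  | ComplexField => @complex.Re R
  end.

Arguments sconj {R k}.
Arguments of_real {R k}.
Arguments real_part {R k}.

Lemma mul_sconj_ge0 (R : realType) (k : field_kind) (x : base_field R k) :
  0 <= x * sconj x.
Proof. by case: k x => x; [exact: sqr_ge0 | exact: mul_conjC_ge0]. Qed.

(* A vector space over [base_field R k], viewed as a real vector space. *)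
Definition realified (R : realType) (k : field_kind)
  (U : lmodType (base_field R k)) : Type := U.

Section RealifiedLmod.
Variables (R : realType) (k : field_kind) (U : lmodType (base_field R k)).

HB.instance Definition _ := GRing.Zmodule.on (realified U).

Let rscale (a : R) (u : realified U) : realified U := of_real a *: (u : U).

Fact rscaleA a b u : rscale a (rscale b u) = rscale (a * b) u.
Proof. by rewrite /rscale scalerA rmorphM. Qed.

Fact rscale1 : left_id 1 rscale.
Proof. by move=> u; rewrite /rscale rmorph1 scale1r. Qed.

Fact rscaleDr : right_distributive rscale +%R.
Proof. by move=> a u v; rewrite /rscale scalerDr. Qed.

Fact rscaleDl u : {morph rscale^~ u : a b / a + b}.
Proof. by move=> a b; rewrite /rscale rmorphD scalerDl. Qed.

HB.instance Definition _ := GRing.Zmodule_isLmodule.Build R (realified U)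
  rscaleA rscale1 rscaleDr rscaleDl.

End RealifiedLmod.

Section Frobenius.
Variables (R : realType) (k : field_kind) (m n : nat).
Local Notation K := (base_field R k).

Definition frobenius (A B : 'M[K]_(m, n)) : K := \tr (A *m B ^t sconj).

Lemma frobeniusE A B : frobenius A B = \sum_i \sum_j A i j * sconj (B i j).
Proof.
apply: eq_bigr => i _; rewrite mxE; apply: eq_bigr => j _.
by rewrite !mxE.
Qed.

Fact frobenius_bilinear :
  bilinear_for *%R (sconj \; *%R) frobenius.
Proof.
split=> [B|A] a; rewrite /frobenius => X Y /=.
  by rewrite mulmxDl -scalemxAl mxtraceD mxtraceZ.
by rewrite linearP/= map_mxD map_mxZ mulmxDr -scalemxAr mxtraceD mxtraceZ.
Qed.

HB.instance Definition _ :=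
  bilinear_isBilinear.Build _ _ _ _ _ _ frobenius frobenius_bilinear.

Fact frobenius_hermitian A B :
  frobenius A B = (-1) ^+ false * sconj (frobenius B A).
Proof.
rewrite expr0 mul1r !frobeniusE rmorph_sum; apply: eq_bigr => i _.
rewrite rmorph_sum; apply: eq_bigr => j _.
by rewrite rmorphM mulrC; congr (_ * _); exact: esym (rmorphK sconj _).
Qed.

HB.instance Definition _ :=
  isHermitianSesquilinear.Build _ _ _ _ frobenius frobenius_hermitian.

Fact frobenius_gt0 A : A != 0 -> 0 < frobenius A A.
Proof.
have ge0 i : 0 <= \sum_j A i j * sconj (A i j).
  by apply: sumr_ge0 => j _; exact: mul_sconj_ge0.
rewrite frobeniusE lt_def sumr_ge0 // andbT; apply: contra => /eqP A0.
apply/eqP/matrixP => i j; rewrite mxE; apply/eqP.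
have Ai0 : \sum_j A i j * sconj (A i j) = 0.
  by apply: (psumr_eq0P _ A0) => // l _; exact: ge0.
have /eqP : A i j * sconj (A i j) = 0.
  by apply: (psumr_eq0P _ Ai0) => // l _; exact: mul_sconj_ge0.
by rewrite mulf_eq0 fmorph_eq0 orbb.
Qed.

HB.instance Definition _ := isDotProduct.Build _ _ frobenius frobenius_gt0.

End Frobenius.

Section DotTheory.
Variables (R : realType) (k : field_kind).
Local Notation K := (base_field R k).

Section DotFacts.
Variables (U : lmodType K) (dot : {dot U for @sconj R k}).

Lemma dot_sumZl I (r : seq I) P (c : I -> K) (x : I -> U) v :
  dot (\sum_(i <- r | P i) c i *: x i) v = \sum_(i <- r | P i) c i * dot (x i) v.
Proof.
by rewrite linear_sumlz; apply: eq_bigr => i _; exact: linearZl_LR.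
Qed.

Lemma dot_sumZr I (r : seq I) P (c : I -> K) (x : I -> U) v :
  dot v (\sum_(i <- r | P i) c i *: x i) =
    \sum_(i <- r | P i) sconj (c i) * dot v (x i).
Proof.
by rewrite linear_sumr; apply: eq_bigr => i _; exact: linearZr_LR.
Qed.

End DotFacts.

Lemma dot_inj (U : vectType K) (dot : {dot U for @sconj R k}) v w :
  (forall u, dot u v = dot u w) -> v = w.
Proof.
move=> vw; apply/eqP; rewrite -subr_eq0; apply: contraT => vw0.
have := @neq0_dnorm_gt0 _ _ _ dot _ vw0.
have -> : dot (v - w) (v - w) = 0.
  by rewrite linearBr; apply/eqP; rewrite subr_eq0; apply/eqP; exact: vw.
by rewrite ltxx.
Qed.

Lemma riesz (U : vectType K) (dot : {dot U for @sconj R k}) (l : {linear U -> K^o}) :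
  exists w, forall u, l u = dot u w.
Proof.
pose n := \dim {:U}; pose e := vbasis {:U}.
pose G : 'M[K]_n := \matrix_(i, j) dot e`_i e`_j.
have expand u : u = \sum_i coord e i u *: e`_i.
  by rewrite -(coord_vbasis (memvf u)).
have Gfree : G \in unitmx.
  rewrite -row_free_unit; apply/inj_row_free => v vG.
  pose u := \sum_i v 0 i *: e`_i.
  have uj (j : 'I_n) : dot u e`_j = 0.
    move/rowP/(_ j): vG; rewrite !mxE => <-; rewrite dot_sumZl.
    by apply: eq_bigr => i _; rewrite mxE.
  have u0 : u = 0.
    apply/eqP/negPn/negP => u_n0; have := @neq0_dnorm_gt0 _ _ _ dot _ u_n0.
    by rewrite {2}/u dot_sumZr big1 ?ltxx // => j _; rewrite uj mulr0.
  apply/rowP => i; rewrite mxE.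
  by have /freeP := basis_free (vbasisP {:U}); apply.
pose c := invmx G *m \col_i l e`_i.
exists (\sum_j sconj (c j 0) *: e`_j) => u.
rewrite [in LHS](expand u) [in RHS](expand u) linear_sum dot_sumZl.
apply: eq_bigr => i _; rewrite linearZ; congr (_ * _).
rewrite dot_sumZr.
have : (G *m c) i 0 = l e`_i by rewrite mulKVmx // mxE.
move=> <-; rewrite mxE; apply: eq_bigr => j _.
rewrite mxE mulrC; congr (_ * _).
exact/esym/(rmorphK sconj).
Qed.

End DotTheory.

Section FrobeniusSub.
Variables (R : realType) (k : field_kind) (m n : nat).
Local Notation K := (base_field R k).
Variable H : {vspace 'M[K]_(m, n)}.

Definition sub_frobenius (A B : subvs_of H) : K := frobenius (vsval A) (vsval B).

Fact sub_frobenius_bilinear :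
  bilinear_for *%R (sconj \; *%R) sub_frobenius.
Proof.
by split=> [B|A] a X Y; rewrite /sub_frobenius linearP ?linearPl ?linearPr.
Qed.

HB.instance Definition _ :=
  bilinear_isBilinear.Build _ _ _ _ _ _ sub_frobenius sub_frobenius_bilinear.

Fact sub_frobenius_hermitian A B :
  sub_frobenius A B = (-1) ^+ false * sconj (sub_frobenius B A).
Proof. exact: hermC. Qed.

HB.instance Definition _ :=
  isHermitianSesquilinear.Build _ _ _ _ sub_frobenius sub_frobenius_hermitian.

Fact sub_frobenius_gt0 A : A != 0 -> 0 < sub_frobenius A A.
Proof. by move=> A0; apply: frobenius_gt0. Qed.

HB.instance Definition _ :=
  isDotProduct.Build _ _ sub_frobenius sub_frobenius_gt0.

(* [vsproj] alone projects along the library's arbitrary complement of [H];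
   applied to a matrix already in [H] it is only the cast to [subvs_of H]. *)
Definition orthoproj (A : 'M[K]_(m, n)) : subvs_of H :=
  vsproj H (daddv_pi H (orthov (@frobenius R k m n) H) A).

Definition orthoproj_compl (A : 'M[K]_(m, n)) : 'M[K]_(m, n) :=
  daddv_pi (orthov (@frobenius R k m n) H) H A.

Local Notation frob := (@frobenius R k m n).

Lemma cap_orthov : (H :&: orthov frob H = 0)%VS.
Proof.
apply/eqP; rewrite -subv0; apply/subvP => A; rewrite memv_cap memv0.
move=> /andP[AH /mem_orthovP/(_ A AH) AA].
by apply: contraT => /frobenius_gt0; rewrite /= AA ltxx.
Qed.

Lemma add_orthov : (H + orthov frob H = fullv)%VS.
Proof.
apply/eqP; rewrite eqEsubv subvf /=; apply/subvP => A _.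
have lin : linear (fun X : subvs_of H => frob (vsval X) A : K^o).
  by move=> a x y; rewrite linearP; exact: linearPl.
pose l := fun X : subvs_of H => frob (vsval X) A : K^o.
pose lT := GRing.isLinear.Build _ _ _ _ l lin.
pose L : {linear subvs_of H -> K^o} := HB.pack l lT.
have [w wP] := riesz sub_frobenius L.
rewrite -(subrK (vsval w) A) addrC memv_add ?subvsP //.
apply/mem_orthovP => B BH; have := wP (vsproj H B).
rewrite /= /l /sub_frobenius vsprojK // => E.
apply/eqP; rewrite herm_eq0C linearBr subr_eq0; apply/eqP; exact: E.
Qed.

Lemma orthoprojE A : vsval (orthoproj A) + orthoproj_compl A = A.
Proof.
rewrite /orthoproj vsprojK ?memv_pi // daddv_pi_add ?cap_orthov //.
by rewrite add_orthov memvf.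
Qed.

Lemma orthoproj_complP A B : B \in H -> frobenius B (orthoproj_compl A) = 0.
Proof.
move=> BH; apply/eqP; rewrite herm_eq0C; apply/eqP.
by have /mem_orthovP/(_ B BH) := memv_pi (orthov frob H) H A.
Qed.

End FrobeniusSub.

Section Euclidean.
Variables (R : realType) (k : field_kind).
Local Notation K := (base_field R k).

Definition sqnorm (U : lmodType K) (dot : {dot U for @sconj R k}) (u : U) : R :=
  real_part (dot u u).

(* The adjoint of [T]: the unique [S] with <T u, v> = <u, S v>. *)
Definition adjoint (U V : vectType K)
    (dotU : {dot U for @sconj R k}) (dotV : {dot V for @sconj R k})
    (T : 'Hom(U, V)) : 'Hom(V, U) :=
  xget 0 [set S : 'Hom(V, U) | forall u v, dotV (T u) v = dotU u (S v)].

Lemma adjointP (U V : vectType K)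
    (dotU : {dot U for @sconj R k}) (dotV : {dot V for @sconj R k})
    (T : 'Hom(U, V)) u v :
  dotV (T u) v = dotU u (adjoint dotU dotV T v).
Proof.
suff [S ST] : exists S : 'Hom(V, U), forall u v, dotV (T u) v = dotU u (S v).
  by rewrite /adjoint; case: xgetP => [S' _ ->//|/(_ S)].
have rz z : exists w, forall u, dotV (T u) z = dotU u w.
  have lin : linear (fun u => dotV (T u) z : K^o).
    move=> a x y; rewrite linearP; exact: linearPl.
  pose lT := GRing.isLinear.Build _ _ _ _ (fun u => dotV (T u) z : K^o) lin.
  pose L : {linear U -> K^o} := HB.pack (fun u => dotV (T u) z : K^o) lT.
  exact: (riesz dotU L).
have /choice[S ST] := rz.
have lS : linear S.
  move=> a x y; apply: (dot_inj (dot := dotU)) => z.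
  apply: (etrans _ (esym (linearPr dotU z a (S x) (S y)))).
  by rewrite /= -!ST; exact: linearPr.
pose lT := GRing.isLinear.Build _ _ _ _ S lS.
pose L : {linear V -> U} := HB.pack S lT.
by exists (linfun L) => x y; rewrite lfunE /= ST.
Qed.

Variables (U : vectType K) (dot : {dot U for @sconj R k}).

(* Loewner order on self-adjoint operators. *)
Definition op_le (S T : 'End(U)) := forall u, 0 <= dot ((T - S) u) u.

Definition op_lt (S T : 'End(U)) := forall u, u != 0 -> 0 < dot ((T - S) u) u.

Definition convex_on_space (f : U -> R) :=
  convex_function (E := realified U) setT f.

Definition strictly_convex_on_space (f : U -> R) :=
  forall (t : {i01 R}) (u v : convex_lmodType (realified U)),
    0 < t%:num < 1 -> u != v -> f (u <| t |> v) < (f u : R^o) <| t |> f v.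

Definition convex_subdifferential (f : U -> R) (u : U) : set U :=
  [set y | forall v, f u + real_part (dot y (v - u)) <= f v].

Definition is_gradient (f : U -> R) (u g : U) :=
  forall e : R, 0 < e -> exists2 d : R, 0 < d & forall v,
    Num.sqrt (sqnorm dot v) < d ->
    `|f (u + v) - f u - real_part (dot g v)| <= e * Num.sqrt (sqnorm dot v).

(* The subdifferential of [f], seen as the sum of the convex function [phi] and
   of the smooth function [f - phi]. *)
Definition subdifferential (f phi : U -> R) (u : U) : set U :=
  [set y + g | y in convex_subdifferential phi u
             & g in is_gradient (f \- phi) u].

Definition stationary_point (f phi : U -> R) (u : U) :=
  subdifferential f phi u 0.

End Euclidean.

Section SingularValues.
Variables (R : realType) (k : field_kind) (m n : nat).
Local Notation K := (base_field R k).

Definition rect_diag (s : 'rV[R]_(minn m n)) : 'M[K]_(m, n) :=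
  \sum_i of_real (s 0 i) *:
    delta_mx (widen_ord (geq_minl m n) i) (widen_ord (geq_minr m n) i).

Record is_svd (A : 'M[K]_(m, n))
    (USV : 'M[K]_m * 'rV[R]_(minn m n) * 'M[K]_n) : Prop := IsSvd {
  svd_unitaryl : USV.1.1 ^t sconj *m USV.1.1 = 1%:M ;
  svd_unitaryr : USV.2 ^t sconj *m USV.2 = 1%:M ;
  svd_ge0 : forall i, 0 <= USV.1.2 0 i ;
  svd_sorted : forall i j : 'I_(minn m n), (i <= j)%N ->
    USV.1.2 0 j <= USV.1.2 0 i ;
  svdE : A = USV.1.1 *m rect_diag USV.1.2 *m USV.2 ^t sconj }.

(* A singular value decomposition of [A].  Which one is chosen is irrelevant:
   the singular values do not depend on it, nor does [sv_calculus f] for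
   [f 0 = 0]. *)
Definition svd (A : 'M[K]_(m, n)) : 'M[K]_m * 'rV[R]_(minn m n) * 'M[K]_n :=
  xget (1%:M, 0, 1%:M) [set USV | is_svd A USV].

Definition singular_value (A : 'M[K]_(m, n)) (i : 'I_(minn m n)) : R :=
  (svd A).1.2 0 i.

Definition sv_calculus (f : R -> R) (A : 'M[K]_(m, n)) : 'M[K]_(m, n) :=
  (svd A).1.1 *m rect_diag (\row_i f (singular_value A i))
    *m (svd A).2 ^t sconj.

Definition rank_regularizer (tau : R) (A : 'M[K]_(m, n)) : R :=
  \sum_i (tau ^+ 2 - Num.max (tau - singular_value A i) 0 ^+ 2).

End SingularValues.

Definition s_fun (R : realType) (tau q sigma : R) : R :=
  Num.max (Num.min sigma tau) (sigma / q).

Section FixedPointOperator.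
Variables (R : realType) (k : field_kind) (m n : nat).
Local Notation K := (base_field R k).
Variables (H : {vspace 'M[K]_(m, n)}) (V : vectType K).
Variable dotV : {dot V for @sconj R k}.
Variables (Mop : 'Hom(subvs_of H, V)) (h : V) (tau q : R).

Definition adjoint_on : 'Hom(V, subvs_of H) :=
  adjoint (@sub_frobenius R k m n H) dotV Mop.

Definition B_op (WA : 'M[K]_(m, n) * subvs_of H) : 'M[K]_(m, n) * subvs_of H :=
  let X := of_real q *: (adjoint_on (h - Mop WA.2) + WA.2) in
  let W' := sv_calculus (s_fun tau q) (vsval X + orthoproj_compl H WA.1) in
  (W', of_real (q - 1)^-1 *: (X - orthoproj H W')).

Definition objective (A : subvs_of H) : R :=
  rank_regularizer tau (vsval A) + q * sqnorm dotV (Mop A - h).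

Definition convex_part (A : subvs_of H) : R :=
  rank_regularizer tau (vsval A) + sqnorm (@frobenius R k m n) (vsval A).

End FixedPointOperator.

(* Main.v *)
Require Import Defs.
From mathcomp Require Import all_boot all_order all_algebra.
From mathcomp Require Import complex.
From mathcomp Require Import boolp classical_sets interval_inference reals convex.
From mathcomp Require Import ring lra.

(** Write [<A, B>] for the real part of the Frobenius product, and let
    [G A = R_tau(A) + |A|^2], which is the sum over the singular values of [A] of a
    convex increasing function [g] ([convex_penalty]).  The objective is [G] plus
    the quadratic polynomial [q |M A - h|^2 - |A|^2] on [H].

    The heart of the matter is the equivalence [half_subgradient_fixed]: [2 W] is
    a subgradient of [G] at [A] if and only if [W] is the image of
    [W + (q - 1) A] under the singular value map of [s_fun].  For numbers, put
    [p c = (c - s c) / (q - 1)]; then [2 s(c)] is a subgradient of [g] at [p c], so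
    that [c = s(c) + (q - 1) p(c)] is the splitting of [c] by a proximal map.
    Applying [s] and [p] to the singular values of a matrix [C] splits [C] in the
    same way, since von Neumann's trace inequality [fdot_svd_le] lifts subgradient
    inequalities from [g] to [G] for matrices with the same singular vectors.
    Uniqueness of the splitting is the monotonicity of subdifferentials.

    Let [Y = q (M^* (h - M A) + A) - (q - 1) A] ([dual_point]).  Unfolding the two
    equations of a fixed point [(W, A)] gives that [W] projects to [Y] on [H], and
    that [W] satisfies the equation above, so [2 W] is a subgradient of [G] at [A]
    ([fixed_pointP]).  On the other side, the smooth part of the objective has
    gradient [- 2 Y] at [A], so [A] is stationary when [2 Y] is a subgradient at
    [A] of the restriction of [G] to [H] ([stationary_pointP]).  Projection leads
    from the first condition to the second.  The converse needs a subgradient of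
    the restriction to extend to the whole matrix space, which is a
    Hahn-Banach argument ([subgradient_extension]).

    Having a subgradient everywhere, [G] is convex; the quadratic polynomial has
    second order part [q |M A|^2 - |A|^2], so the objective is convex or strictly
    convex when this form is nonnegative or positive ([objective_conv]).

    All this presupposes singular value decompositions of real and complex
    matrices.  They are constructed uniformly by splitting off the largest
    singular value ([top_singular_vector], [svd_ind]). *)

Set Implicit Arguments.
Unset Strict Implicit.
Unset Printing Implicit Defensive.

Import Order.TTheory GRing.Theory Num.Theory.

Local Open Scope ring_scope.
Local Open Scope sesquilinear_scope.
Local Open Scope classical_set_scope.

(** * Real and complex scalars *)

Section Scalars.
Variables (R : realType) (k : field_kind).
Local Notation K := (base_field R k).
Implicit Types (x y z : K) (a : R).

Lemma real_partD x y : real_part (x + y) = real_part x + real_part y.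
Proof. by case: k x y => [x y|[a b] [c d]]. Qed.

Lemma real_partN x : real_part (- x) = - real_part x.
Proof. by case: k x => [x|[a b]]. Qed.

Lemma real_part0 : real_part (0 : K) = 0.
Proof. by case: k. Qed.

Lemma real_part_sum I (r : seq I) P (F : I -> K) :
  real_part (\sum_(i <- r | P i) F i) = \sum_(i <- r | P i) real_part (F i).
Proof. by apply: big_morph; [exact: real_partD | exact: real_part0]. Qed.

Lemma real_partZ a x : real_part (of_real a * x) = a * real_part x.
Proof. by case: k x => [x|[c d]] //=; rewrite mul0r subr0. Qed.

Lemma of_realK a : real_part (of_real a : K) = a.
Proof. by case: k. Qed.

Lemma real_part_conj x : real_part (sconj x) = real_part x.
Proof. by case: k x => [x|[a b]]. Qed.

Lemma sconj_of_real a : sconj (of_real a : K) = of_real a.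
Proof. by case: k => //=; congr (_ +i* _)%C; exact: oppr0. Qed.

Lemma sconjK x : sconj (sconj x) = x.
Proof. exact: (rmorphK sconj). Qed.

Lemma sconjM x y : sconj (x * y) = sconj x * sconj y.
Proof. exact: (rmorphM sconj). Qed.

Lemma sconjB x y : sconj (x - y) = sconj x - sconj y.
Proof. exact: (rmorphB sconj). Qed.

Lemma sconjV x : sconj x^-1 = (sconj x)^-1.
Proof. exact: (fmorphV sconj). Qed.

Lemma of_real_ge0 x : 0 <= x -> of_real (real_part x) = x.
Proof. by case: k x => [x|[a b]] //=; rewrite lecE /= => /andP[/eqP ->]. Qed.

Lemma real_part_ge0 x : 0 <= x -> 0 <= real_part x.
Proof. by case: k x => [x|[a b]] //=; rewrite lecE /= => /andP[]. Qed.

Lemma real_part_gt0 x : 0 < x -> 0 < real_part x.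
Proof. by case: k x => [x|[a b]] //=; rewrite ltcE /= => /andP[]. Qed.

Lemma of_real_inj : injective (of_real : R -> K).
Proof. exact: fmorph_inj. Qed.

(** The squared modulus, as an element of [R]: the norm of [K] takes values in [K],
    while all inequalities below are between reals. *)
Definition sqabs x : R := real_part (x * sconj x).

Lemma sqabs_ge0 x : 0 <= sqabs x.
Proof. by apply: real_part_ge0; exact: mul_sconj_ge0. Qed.

Lemma sqabsE x : x * sconj x = of_real (sqabs x).
Proof. by rewrite /sqabs of_real_ge0 // mul_sconj_ge0. Qed.

Lemma sqabs_eq0 x : sqabs x = 0 -> x = 0.
Proof.
move=> x0; have /eqP := sqabsE x.
by rewrite x0 rmorph0 mulf_eq0 fmorph_eq0 orbb => /eqP.
Qed.

(** Expand [0 <= sqabs (x - y)]. *)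
Lemma real_part_mul_le x y :
  real_part (x * sconj y) <= (sqabs x + sqabs y) / 2%:R.
Proof.
have := sqabs_ge0 (x - y); rewrite /sqabs sconjB mulrBl !mulrBr.
rewrite !(real_partD, real_partN).
have -> : real_part (y * sconj x) = real_part (x * sconj y).
  by rewrite -real_part_conj sconjM sconjK mulrC.
by lra.
Qed.

(** The phase lets the Householder reflection of [unitary_completion] reach any
    unit vector over the complex numbers, where a reflection can only exchange
    [x] and [y] when their inner product is real. *)
Lemma phase_exists x :
  exists2 t : K, sconj t * t = 1 & exists2 a, 0 <= a & t * x = of_real a.
Proof.
have [->|x0] := eqVneq x 0.
  by exists 1; [rewrite rmorph1 mulr1 | exists 0; rewrite // mulr0 rmorph0].
pose r := Num.sqrt (sqabs x).
have s0 : 0 < sqabs x.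
  by rewrite lt_neqAle sqabs_ge0 andbT eq_sym; apply: contraNneq x0 => /sqabs_eq0 ->.
have r0 : 0 < r by rewrite sqrtr_gt0.
have rr : r * r = sqabs x by rewrite -expr2 sqr_sqrtr // ltW.
have rn0 : of_real r != 0 :> K by rewrite fmorph_eq0 gt_eqF.
have rrK : of_real r * of_real r = x * sconj x :> K by rewrite -rmorphM rr sqabsE.
exists ((of_real r)^-1 * sconj x); last first.
  by exists r; [exact: ltW | rewrite -mulrA [sconj x * x]mulrC -rrK mulKf].
rewrite sconjM sconjV sconjK sconj_of_real mulrACA [x * _]mulrC.
by rewrite [sconj x * x]mulrC -rrK -invfM mulVf // mulf_neq0.
Qed.

End Scalars.

(** * The real inner product underlying a dot product *)

Section RealDot.
Variables (R : realType) (k : field_kind).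
Local Notation K := (base_field R k).
Variables (U : lmodType K) (dot : {dot U for @sconj R k}).
Implicit Types (u v w : U) (a : R).

Definition rdot u v : R := real_part (dot u v).

Local Notation "'[ u , v ]" := (rdot u v).

Lemma rdotC u v : '[u, v] = '[v, u].
Proof. by rewrite /rdot hermC expr0 mul1r real_part_conj. Qed.

Lemma rdotDl u v w : '[u + v, w] = '[u, w] + '[v, w].
Proof. by rewrite /rdot linearDl real_partD. Qed.

Lemma rdotNl u w : '[- u, w] = - '[u, w].
Proof. by rewrite /rdot linearNl real_partN. Qed.

Lemma rdotZl a u w : '[of_real a *: u, w] = a * '[u, w].
Proof. by rewrite /rdot linearZl_LR real_partZ. Qed.

Lemma rdotBl u v w : '[u - v, w] = '[u, w] - '[v, w].
Proof. by rewrite rdotDl rdotNl. Qed.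

Lemma rdotDr u v w : '[w, u + v] = '[w, u] + '[w, v].
Proof. by rewrite !(rdotC w) rdotDl. Qed.

Lemma rdotNr u w : '[w, - u] = - '[w, u].
Proof. by rewrite !(rdotC w) rdotNl. Qed.

Lemma rdotZr a u w : '[w, of_real a *: u] = a * '[w, u].
Proof. by rewrite !(rdotC w) rdotZl. Qed.

Lemma rdotBr u v w : '[w, u - v] = '[w, u] - '[w, v].
Proof. by rewrite rdotDr rdotNr. Qed.

Lemma rdot0l w : '[0, w] = 0.
Proof. by rewrite /rdot linear0l real_part0. Qed.

Lemma rdot0r w : '[w, 0] = 0.
Proof. by rewrite rdotC rdot0l. Qed.

Lemma dot_ge0 u : 0 <= dot u u.
Proof.
have [->|u0] := eqVneq u 0; first by rewrite linear0l.
by apply/ltW/neq0_dnorm_gt0.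
Qed.

Lemma dot_of_rdot u : dot u u = of_real '[u, u].
Proof. by rewrite of_real_ge0 // dot_ge0. Qed.

Lemma rdot_ge0 u : 0 <= '[u, u].
Proof. exact/real_part_ge0/dot_ge0. Qed.

Lemma rdot_gt0 u : u != 0 -> 0 < '[u, u].
Proof. by move=> u0; apply/real_part_gt0/neq0_dnorm_gt0. Qed.

Lemma rdot_eq0 u : '[u, u] = 0 -> u = 0.
Proof.
move=> uu; apply: contra_eq uu => /rdot_gt0.
by rewrite lt_neqAle eq_sym => /andP[].
Qed.

Lemma sq_dotZ (c : K) u : '[c *: u, c *: u] = sqabs c * '[u, u].
Proof.
by rewrite {1}/rdot linearZl_LR linearZr_LR /= mulrA sqabsE real_partZ.
Qed.

Lemma sq_rdotD_le u v : '[u + v, u + v] <= 2 * '[u, u] + 2 * '[v, v].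
Proof.
have := rdot_ge0 (u - v).
by rewrite !(rdotDl, rdotDr, rdotNl, rdotNr) (rdotC v u); lra.
Qed.

(** The last term measures how convex a quadratic form is; it turns the operator
    inequalities on the adjoint product into convexity of the objective. *)
Lemma sq_rdot_conv a u v :
  let w := of_real a *: u + of_real (1 - a) *: v in
  '[w, w] = a * '[u, u] + (1 - a) * '[v, v] - a * (1 - a) * '[u - v, u - v].
Proof.
rewrite /= !(rdotDl, rdotDr, rdotNl, rdotNr, rdotZl, rdotZr) (rdotC v u).
by ring.
Qed.

End RealDot.

(** * Adjoint matrices and the real Frobenius product *)

Section AdjointMatrix.
Variables (R : realType) (k : field_kind).
Local Notation K := (base_field R k).
Local Notation "A ^H" := (A ^t (@sconj R k)) (at level 8, format "A ^H").

Lemma ctrmxM m n p (A : 'M[K]_(m, n)) (B : 'M[K]_(n, p)) :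
  (A *m B)^H = B^H *m A^H.
Proof. by rewrite trmx_mul; exact: (map_mxM sconj). Qed.

Lemma ctrmxK m n (A : 'M[K]_(m, n)) : A^H^H = A.
Proof. by apply/matrixP => i j; rewrite !mxE sconjK. Qed.

Lemma ctrmx1 n : (1%:M : 'M[K]_n)^H = 1%:M.
Proof. by rewrite trmx1; exact: (map_mx1 sconj). Qed.

Lemma unitary_mulmxC n (U : 'M[K]_n) : U^H *m U = 1%:M -> U *m U^H = 1%:M.
Proof. exact: mulmx1C. Qed.

Lemma unitaryM n (U V : 'M[K]_n) :
  U^H *m U = 1%:M -> V^H *m V = 1%:M -> (U *m V)^H *m (U *m V) = 1%:M.
Proof. by move=> UU VV; rewrite ctrmxM mulmxA -(mulmxA V^H) UU mulmx1. Qed.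

Lemma unitaryV n (U : 'M[K]_n) : U^H *m U = 1%:M -> U^H^H *m U^H = 1%:M.
Proof. by move=> UU; rewrite ctrmxK unitary_mulmxC. Qed.

Definition fdot m n (A B : 'M[K]_(m, n)) : R := rdot (@frobenius R k m n) A B.

Local Notation "'[ A , B ]" := (fdot A B).

Lemma fdotE m n (A B : 'M[K]_(m, n)) :
  '[A, B] = \sum_i \sum_j real_part (A i j * sconj (B i j)).
Proof.
rewrite /fdot /rdot /= frobeniusE real_part_sum.
by apply: eq_bigr => i _; rewrite real_part_sum.
Qed.

Lemma sq_fdotE m n (A : 'M[K]_(m, n)) : '[A, A] = \sum_i \sum_j sqabs (A i j).
Proof. exact: fdotE. Qed.

Lemma fdot_mull m n p (A : 'M[K]_(m, n)) (X : 'M[K]_(n, p)) Y :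
  '[A *m X, Y] = '[X, A^H *m Y].
Proof.
rewrite /fdot /rdot /= /frobenius ctrmxM ctrmxK.
by rewrite -mulmxA mxtrace_mulC -mulmxA.
Qed.

Lemma fdot_mulr m n p (X : 'M[K]_(m, n)) (A : 'M[K]_(n, p)) Y :
  '[X *m A, Y] = '[X, Y *m A^H].
Proof. by rewrite /fdot /rdot /= /frobenius ctrmxM ctrmxK mulmxA. Qed.

Lemma fdot_unitary_l m n (U : 'M[K]_m) (X Y : 'M[K]_(m, n)) :
  U^H *m U = 1%:M -> '[U *m X, U *m Y] = '[X, Y].
Proof. by move=> UU; rewrite fdot_mull mulmxA UU mul1mx. Qed.

(** Boundedness is stable under sums, so it suffices to check elementary
    matrices. *)
Lemma mx_bounded m n (B : 'M[K]_(m, n)) :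
  exists2 b, 0 <= b & forall w : 'cV[K]_n, '[B *m w, B *m w] <= b * '[w, w].
Proof.
rewrite (matrix_sum_delta B).
pose bounded (C : 'M[K]_(m, n)) :=
  exists2 b, 0 <= b & forall w : 'cV[K]_n, '[C *m w, C *m w] <= b * '[w, w].
have b0 : bounded 0.
  by exists 0 => // w; rewrite mul0mx mul0r /fdot rdot0l.
have bD C D : bounded C -> bounded D -> bounded (C + D).
  move=> [c c0 cP] [d d0 dP]; exists (2 * c + 2 * d).
    by rewrite addr_ge0 // mulr_ge0.
  move=> w; rewrite mulmxDl; apply: le_trans (sq_rdotD_le _ _ _) _.
  by move: (cP w) (dP w); rewrite /fdot; lra.
apply: (big_ind bounded) => // i _; apply: (big_ind bounded) => // j _.
exists (sqabs (B i j)) => [|w]; first exact: sqabs_ge0.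
rewrite -scalemxAl /fdot sq_dotZ; apply: ler_wpM2l; first exact: sqabs_ge0.
rewrite -/(fdot _ _) -/(fdot _ _) !sq_fdotE (bigD1 i) //= [X in _ + X]big1; last first.
  move=> l li; rewrite big1 // => z _; rewrite mxE big1 ?/sqabs ?mul0r ?real_part0 // => o _.
  by rewrite mxE (negPf li) mul0r.
rewrite addr0 [leRHS](bigD1 j) //= !big_ord1.
have -> : (delta_mx i j *m w) i 0 = w j 0.
  rewrite mxE (bigD1 j) //= mxE !eqxx mul1r big1 ?addr0 // => o oj.
  by rewrite mxE eqxx (negPf oj) mul0r.
rewrite lerDl; apply: sumr_ge0 => o _; rewrite big_ord1; exact: sqabs_ge0.
Qed.

End AdjointMatrix.

(** * Existence of singular value decompositions *)

Section SingularVector.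
Variables (R : realType) (k : field_kind).
Local Notation K := (base_field R k).
Local Notation "A ^H" := (A ^t (@sconj R k)) (at level 8, format "A ^H").
Local Notation "'[ A , B ]" := (fdot A B).

(** Let [l] be the least bound in [|A w|^2 <= l |w|^2], and consider the positive
    semidefinite matrix [T = l - A^H A].  The Cauchy-Schwarz inequality for the
    form of [T] gives [|T v|^2 <= (l + 1) <T v, v>].  If [T] were invertible, then
    [|v|^2] would be at most a multiple of [<T v, v>], and [l] could be decreased.
    A unit vector in the kernel of [T] is the wanted one.  The argument uses
    neither compactness nor roots of polynomials, so it covers real and complex
    scalars at once. *)
Lemma top_singular_vector m n (A : 'M[K]_(m, n.+1)) :
  exists l (v : 'cV[K]_n.+1),
    [/\ '[v, v] = 1, A^H *m (A *m v) = of_real l *: v &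
        forall w : 'cV[K]_n.+1, '[A *m w, A *m w] <= l * '[w, w]].
Proof.
pose S : set R := [set c | forall w : 'cV[K]_n.+1, '[A *m w, A *m w] <= c * '[w, w]].
have [b b0 bP] := mx_bounded A.
have lbS (w : 'cV[K]_n.+1) : w != 0 -> lbound S ('[A *m w, A *m w] / '[w, w]).
  by move=> /(rdot_gt0 (@frobenius R k _ _)) w0 c cS; rewrite ler_pdivrMr //; exact: cS.
have hinf : has_inf S.
  split; first by exists b.
  pose w0 : 'cV[K]_n.+1 := delta_mx 0 0.
  exists ('[A *m w0, A *m w0] / '[w0, w0]).
  apply: lbS; apply/negP => /eqP/matrixP/(_ 0 0)/eqP.
  by rewrite !mxE eqxx oner_eq0.
pose l := inf S.
have lP (w : 'cV[K]_n.+1) : '[A *m w, A *m w] <= l * '[w, w].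
  have [->|w0] := eqVneq w 0; first by rewrite mulmx0 /fdot !rdot0l mulr0.
  rewrite -ler_pdivrMr; last exact: rdot_gt0.
  apply: lb_le_inf; [exact: hinf.1 | exact: lbS].
have l0 : 0 <= l.
  apply: lb_le_inf; first exact: hinf.1.
  move=> c /(_ (delta_mx 0 0)) cP.
  have d0 : 0 < '[delta_mx 0 0 : 'cV[K]_n.+1, delta_mx 0 0].
    apply: rdot_gt0; apply/negP => /eqP/matrixP/(_ 0 0)/eqP.
    by rewrite !mxE eqxx oner_eq0.
  by rewrite -(pmulr_lge0 _ d0); apply: le_trans cP; exact: rdot_ge0.
pose T : 'M[K]_n.+1 := (of_real l)%:M - A^H *m A.
have TE (x y : 'cV[K]_n.+1) : '[T *m x, y] = l * '[x, y] - '[A *m x, A *m y].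
  rewrite mulmxBl mul_scalar_mx {1}/fdot rdotBl rdotZl; congr (_ - _).
  by rewrite -/(fdot _ _) -mulmxA [LHS]fdot_mull ctrmxK.
suff : T \notin unitmx.
  rewrite -unitmx_tr unitmxE unitfE negbK => /det0P[v v0].
  move/(congr1 trmx); rewrite trmx_mul trmxK trmx0 => Tv.
  have vT0 : v^T != 0 by rewrite -(inj_eq trmx_inj) trmxK trmx0.
  have vv : 0 < '[v^T, v^T] by exact: rdot_gt0.
  pose c := (Num.sqrt '[v^T, v^T])^-1.
  exists l, (of_real c *: v^T); split => //.
    rewrite /fdot rdotZl rdotZr -/(fdot _ _) mulrA -invfM -expr2 sqr_sqrtr ?ltW //.
    by rewrite mulVf // gt_eqF.
  apply/eqP; rewrite eq_sym -subr_eq0 mulmxA -mul_scalar_mx -mulmxBl -/T.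
  by rewrite -scalemxAr Tv scaler0.
apply/negP => Tunit.
have Tsq (v : 'cV[K]_n.+1) : '[T *m v, T *m v] <= (l + 1) * '[T *m v, v].
  set w := T *m v; pose s := (l + 1)^-1.
  have s0 : 0 < s by rewrite invr_gt0; lra.
  have sl : s * (l + 1) = 1 by rewrite mulVf // gt_eqF //; lra.
  have pos (x : 'cV[K]_n.+1) : 0 <= '[T *m x, x] by rewrite TE subr_ge0.
  (* The step [s] minimizes [<T v, v> - 2 s |w|^2 + s^2 (l + 1) |w|^2], an upper bound. *)
  have := pos (v - of_real s *: w).
  rewrite mulmxBr -scalemxAr -/w /fdot.
  rewrite !(rdotBl, rdotBr, rdotZl, rdotZr) -!/(fdot _ _).
  have -> : '[T *m w, v] = '[w, w].
    by rewrite TE {1}/fdot rdotC [X in _ - X]rdotC -!/(fdot _ _) -TE.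
  have : '[T *m w, w] <= l * '[w, w] by rewrite TE gerBl; exact: rdot_ge0.
  have := rdot_ge0 (@frobenius R k _ _) w; rewrite -/(fdot _ _).
  move: '[T *m w, w] '[w, w] '[w, v] => tww ww wv ww0 tle h.
  have : s * (s * tww) <= s * ww.
    rewrite ler_pM2l // -[leRHS]mul1r -sl -mulrA; apply: ler_wpM2l; first exact: ltW.
    by lra.
  move=> h2; have h3 : s * ww <= wv by lra.
  by rewrite -(ler_pM2l s0) mulrA sl mul1r.
have [d d0 dP] := mx_bounded (invmx T).
pose e := d * (l + 1) + 1.
have e0 : 0 < e by rewrite ltr_pwDr // mulr_ge0 // addr_ge0.
have eS : S (l - e^-1).
  move=> v; have t0 : 0 <= '[T *m v, v] by rewrite TE subr_ge0.
  have := dP (T *m v); rewrite mulKmx // => vle.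
  have : '[v, v] <= e * '[T *m v, v].
    apply: le_trans vle _; rewrite mulrDl mul1r -mulrA.
    apply: ler_wpDr => //; apply: ler_wpM2l => //; exact: Tsq.
  rewrite mulrC -ler_pdivrMr // TE mulrBl [_ / _]mulrC; lra.
have := ge_inf hinf.2 eS; rewrite -/l lerBrDl gerDr invr_le0.
by rewrite leNgt e0.
Qed.

End SingularVector.

Section Svd.
Variables (R : realType) (k : field_kind).
Local Notation K := (base_field R k).
Local Notation "A ^H" := (A ^t (@sconj R k)) (at level 8, format "A ^H").
Local Notation "'[ A , B ]" := (fdot A B).

Lemma ctrmxZ m n (c : K) (A : 'M[K]_(m, n)) : (c *: A)^H = sconj c *: A^H.
Proof. by apply/matrixP => i j; rewrite !mxE sconjM. Qed.

Lemma ctrmxB m n (A B : 'M[K]_(m, n)) : (A - B)^H = A^H - B^H.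
Proof. by apply/matrixP => i j; rewrite !mxE sconjB. Qed.

Lemma ctrmx_mul_col n (v : 'cV[K]_n) : v^H *m v = (of_real '[v, v])%:M.
Proof.
rewrite [LHS]mx11_scalar; congr (_%:M).
by rewrite -dot_of_rdot /= /frobenius mxtrace_mulC /mxtrace big_ord1.
Qed.

(** After multiplication by a phase, the first coordinate [a] of [u] is real and
    the Householder reflection along [w = u' - e] takes the first basis vector [e]
    to this multiple [u'] of [u].  When [a = 1] we have [w = 0], and the formula still works because
    the inverse of [0] is [0]. *)
Lemma unitary_completion n (u : 'cV[K]_n.+1) : '[u, u] = 1 ->
  exists2 U : 'M[K]_n.+1, U^H *m U = 1%:M & U *m delta_mx 0 0 = u.
Proof.
move=> uu; have [t tt [a a0 ta]] := phase_exists (u 0 0).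
pose u' := t *: u; pose e : 'cV[K]_n.+1 := delta_mx 0 0; pose w := u' - e.
have ee : '[e, e] = 1.
  rewrite sq_fdotE (bigD1 0) //= big_ord1 mxE eqxx big1 ?addr0; last first.
    by move=> i i0; rewrite big_ord1 mxE (negPf i0) /sqabs mul0r real_part0.
  by apply: (@of_real_inj R k); rewrite -sqabsE !rmorph1 mulr1.
have u'e : '[u', e] = a.
  rewrite fdotE (bigD1 0) //= big_ord1 !mxE ta eqxx /= rmorph1 mulr1 of_realK.
  rewrite big1 ?addr0 // => i i0.
  by rewrite big_ord1 !mxE (negPf i0) /= rmorph0 mulr0 real_part0.
have u'u' : '[u', u'] = 1.
  rewrite /fdot sq_dotZ -/(fdot _ _) uu mulr1.
  by apply: (@of_real_inj R k); rewrite -sqabsE mulrC tt rmorph1.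
have ww : '[w, w] = 2 * (1 - a).
  rewrite /fdot !(rdotBl, rdotBr) (rdotC _ e) -!/(fdot _ _) u'u' ee u'e; ring.
have we : w^H *m e = (of_real (a - 1))%:M.
  rewrite [LHS]mx11_scalar; congr (_%:M).
  rewrite mxE (bigD1 0) //= !mxE eqxx mulr1 big1; last first.
    by move=> i i0; rewrite [e _ _]mxE (negPf i0) mulr0.
  by rewrite ta addr0 sconjB sconj_of_real !rmorph1 rmorphB rmorph1.
pose c := (1 - a)^-1; pose P := w *m w^H.
have PP : P *m P = of_real (2 * (1 - a)) *: P.
  by rewrite mulmxA -(mulmxA w) ctrmx_mul_col ww mul_mx_scalar scalemxAl.
have PH : P^H = P by rewrite ctrmxM ctrmxK.
pose H : 'M[K]_n.+1 := 1%:M - of_real c *: P.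
have HH : H^H *m H = 1%:M.
  rewrite ctrmxB ctrmx1 ctrmxZ PH sconj_of_real -/H /H.
  rewrite mulmxBl mul1mx mulmxBr mulmx1 -scalemxAl -scalemxAr PP !scalerA.
  rewrite -!rmorphM; have -> : c * c * (2 * (1 - a)) = c + c.
    rewrite /c; have [->|a1] := eqVneq (1 - a) 0; first by rewrite invr0; ring.
    by field.
  by rewrite rmorphD scalerDl opprB addrK subrK.
have He : H *m e = u'.
  rewrite mulmxBl mul1mx -scalemxAl -mulmxA we mul_mx_scalar scalerA -rmorphM.
  have [a1|a1] := eqVneq (1 - a) 0.
    rewrite /c a1 invr0 mul0r rmorph0 scale0r subr0; apply/eqP.
    rewrite eq_sym -subr_eq0 -/w; apply/eqP.
    by apply: (@rdot_eq0 _ _ _ (@frobenius R k _ _)); rewrite -/(fdot _ _) ww a1 mulr0.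
  have -> : c * (a - 1) = - 1 by rewrite /c; field.
  by rewrite rmorphN rmorph1 scaleN1r opprK /w addrC subrK.
exists (sconj t *: H).
  by rewrite ctrmxZ sconjK -scalemxAl -scalemxAr HH scalerA [t * _]mulrC tt scale1r.
by rewrite -scalemxAl He scalerA tt scale1r.
Qed.

(** A rectangular diagonal matrix whose diagonal is indexed by [nat], so that its
    first entry can be split off without transporting along an equation for
    [minn m n]. *)
Definition diag_of m n (f : nat -> R) : 'M[K]_(m, n) :=
  \matrix_(i, j) (if i == j :> nat then of_real (f i) else 0).

Lemma deflate_block m n (s : R) (B : 'M[K]_(1 + m, 1 + n)) :
    B *m delta_mx 0 0 = of_real s *: (delta_mx 0 0 : 'cV_(1 + m)) ->
    (delta_mx 0 0 : 'rV_(1 + m)) *m B = of_real s *: (delta_mx 0 0 : 'rV_(1 + n)) ->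
  B = block_mx (of_real s)%:M 0 0 (drsubmx B).
Proof.
move=> Bcol Brow.
rewrite -[LHS]submxK; congr block_mx; apply/matrixP => i j.
- rewrite !ord1 !mxE eqxx /= mulr1n.
  have /matrixP/(_ 0 0) := Bcol; rewrite -colE mxE => E.
  transitivity (B 0 0); first by congr (B _ _); apply/val_inj.
  by rewrite E !mxE ?eqxx ?mulr1.
- rewrite !ord1 !mxE.
  have /matrixP/(_ 0 (rshift 1 j)) := Brow; rewrite -rowE mxE => E.
  transitivity (B 0 (rshift 1 j)); first by congr (B _ _); apply/val_inj.
  by rewrite E !mxE ?andbF ?mulr0.
- rewrite !ord1 !mxE.
  have /matrixP/(_ (rshift 1 i) 0) := Bcol; rewrite -colE mxE => E.
  transitivity (B (rshift 1 i) 0); first by congr (B _ _); apply/val_inj.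
  by rewrite E !mxE ?andbF ?mulr0.
Qed.

Lemma diag_block m n (s : R) (f : nat -> R) :
  block_mx (of_real s)%:M 0 0 (diag_of m n f) =
    diag_of (1 + m) (1 + n) (fun i => if i is i'.+1 then f i' else s).
Proof.
apply/matrixP => i j.
case: (split_ordP i) => i' ->; case: (split_ordP j) => j' ->;
  rewrite ?(block_mxEul, block_mxEur, block_mxEdl, block_mxEdr) !mxE /=.
- by rewrite !ord1.
- by rewrite !ord1.
- by rewrite !ord1.
- by rewrite !add1n eqSS.
Qed.

(** Induction on the size: the unit vectors [v] and [u = A v / s] attached to the
    top singular value [s] are completed to unitary matrices, which brings [A]
    to block form.  The bound [c] is carried along so that the singular values of
    the remaining block are known to be at most [s], which makes the resulting
    sequence nonincreasing. *)
Lemma svd_ind m n (A : 'M[K]_(m, n)) (c : R) : 0 <= c ->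
    (forall w : 'cV[K]_n, '[A *m w, A *m w] <= c ^+ 2 * '[w, w]) ->
  exists (U : 'M[K]_m) (V : 'M[K]_n) (f : nat -> R),
    [/\ U^H *m U = 1%:M, V^H *m V = 1%:M, U^H *m A *m V = diag_of m n f,
        forall i, 0 <= f i <= c & forall i j, (i <= j)%N -> f j <= f i].
Proof.
elim: m n A c => [|m IHm] [|n] A c c0 Ac.
1-3: by exists 1%:M, 1%:M, (fun=> 0); rewrite ?ctrmx1 ?mulmx1; split=> //;
  first [by apply/matrixP => -[] | by apply/matrixP => ? []
        | by move=> _; rewrite lexx].
have [l [v [vv AAv Al]]] := top_singular_vector A.
have l0 : 0 <= l by rewrite -[l]mulr1 -vv; apply: le_trans (Al v); exact: rdot_ge0.
have Avl : '[A *m v, A *m v] = l.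
  by rewrite fdot_mull AAv /fdot rdotZr -/(fdot _ _) vv mulr1.
have [l00|ln0] := eqVneq l 0.
  exists 1%:M, 1%:M, (fun=> 0); rewrite ?ctrmx1 ?mulmx1 mul1mx; split=> //; last first.
    by move=> _; rewrite lexx.
  apply/matrixP => i j; rewrite !mxE rmorph0 if_same.
  have Aj : A *m (delta_mx j 0 : 'cV_n.+1) = 0.
    apply: (@rdot_eq0 _ _ _ (@frobenius R k _ _)); apply/eqP.
    by rewrite eq_le rdot_ge0 andbT; have := Al (delta_mx j 0); rewrite l00 mul0r.
  by have /matrixP/(_ i 0) := Aj; rewrite -colE !mxE.
pose s := Num.sqrt l.
have s0 : 0 < s by rewrite sqrtr_gt0 lt_neqAle eq_sym ln0.
have ss : s * s = l by rewrite -expr2 sqr_sqrtr.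
have sK0 : of_real s != 0 :> K by rewrite fmorph_eq0 gt_eqF.
have sc : s <= c.
  rewrite -(ler_pXn2r (n := 2)) ?nnegrE ?(ltW s0) // expr2 ss.
  by have := Ac v; rewrite Avl vv mulr1.
pose u := of_real s^-1 *: (A *m v).
have uu : '[u, u] = 1.
  rewrite /fdot rdotZl rdotZr -/(fdot _ _) Avl -ss; field.
  by rewrite gt_eqF.
have [U UU Ue] := unitary_completion uu.
have [V VV Ve] := unitary_completion vv.
pose B : 'M[K]_(1 + m, 1 + n) := U^H *m A *m V.
have Bw (w : 'cV[K]_(1 + n)) : '[B *m w, B *m w] <= l * '[w, w].
  rewrite /B -!mulmxA fdot_unitary_l; last exact: unitaryV.
  by apply: le_trans (Al _) _; rewrite fdot_unitary_l.
have Bcol : B *m delta_mx 0 0 = of_real s *: (delta_mx 0 0 : 'cV_(1 + m)).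
  rewrite -[LHS]mulmxA Ve -mulmxA.
  have -> : A *m v = of_real s *: u.
    by rewrite scalerA -rmorphM divff ?rmorph1 ?scale1r // gt_eqF.
  by rewrite -scalemxAr -Ue mulmxA UU mul1mx.
have Brow : (delta_mx 0 0 : 'rV_(1 + m)) *m B = of_real s *: (delta_mx 0 0 : 'rV_(1 + n)).
  have dH p : (delta_mx 0 0 : 'rV[K]_p.+1) = (delta_mx 0 0 : 'cV_p.+1)^H.
    apply/matrixP => i j; rewrite !mxE andbC.
    by case: (_ && _); rewrite ?rmorph1 ?rmorph0.
  have BHe : B^H *m (delta_mx 0 0 : 'cV_m.+1) = of_real s *: (delta_mx 0 0 : 'cV_n.+1).
    rewrite !ctrmxM ctrmxK -!mulmxA Ue -scalemxAr AAv scalerA -rmorphM.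
    by rewrite -ss mulKf ?gt_eqF // -scalemxAr -Ve mulmxA VV mul1mx.
  by rewrite !dH -[B]ctrmxK -ctrmxM BHe ctrmxZ sconj_of_real.
pose A' := drsubmx B.
have A'w (w : 'cV[K]_n) : '[A' *m w, A' *m w] <= s ^+ 2 * '[w, w].
  have := Bw (col_mx 0 w).
  have -> : B *m col_mx 0 w = col_mx (ursubmx B *m w) (A' *m w).
    by rewrite -[B in LHS]submxK mul_block_col !mulmx0 !add0r.
  have cmE p (x : 'cV[K]_1) (y : 'cV[K]_p) : '[col_mx x y, col_mx x y] = '[x, x] + '[y, y].
    rewrite !sq_fdotE big_split_ord /=; congr (_ + _).
      by apply: eq_bigr => i _; apply: eq_bigr => j _; rewrite col_mxEu.
    by apply: eq_bigr => i _; apply: eq_bigr => j _; rewrite col_mxEd.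
  rewrite !cmE [fdot 0 0]rdot0l add0r expr2 ss; apply: le_trans.
  by rewrite lerDr; exact: rdot_ge0.
have BE := deflate_block Bcol Brow.
have [U' [V' [f [UU' VV' E fP fS]]]] := IHm n A' s (ltW s0) A'w.
have ctr_block p (X : 'M[K]_p) : (block_mx (1%:M : 'M_1) 0 0 X)^H = block_mx 1%:M 0 0 X^H.
  rewrite tr_block_mx map_block_mx !trmx0 !(map_mx0 sconj); congr block_mx.
  exact: ctrmx1.
have unit_block p (X : 'M[K]_p) : X^H *m X = 1%:M ->
    (block_mx (1%:M : 'M_1) 0 0 X)^H *m (block_mx 1%:M 0 0 X) = 1%:M.
  move=> XX; rewrite ctr_block mulmx_block !mulmx0 !mul0mx !mulmx1 !addr0 add0r XX.
  by rewrite -scalar_mx_block.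
pose U1 : 'M[K]_(1 + m) := block_mx 1%:M 0 0 U'.
pose V1 : 'M[K]_(1 + n) := block_mx 1%:M 0 0 V'.
exists (U *m U1), (V *m V1).
exists (fun i => if i is i'.+1 then f i' else s); split.
- by apply: unitaryM => //; exact: unit_block.
- by apply: unitaryM => //; exact: unit_block.
- transitivity (U1^H *m B *m V1); first by rewrite /B ctrmxM !mulmxA.
  rewrite /U1 /V1 ctr_block BE !mulmx_block !mulmx0 !mul0mx !mulmx1 !mul1mx.
  rewrite !addr0 !add0r -/A' E.
  by rewrite ?mul0mx; exact: diag_block.
- case=> [|i]; first by rewrite (ltW s0) sc.
  by have /andP[-> fs] := fP i; rewrite (le_trans fs).
- case=> [|i] [|j] // ij; last exact: fS.
  by have /andP[] := fP j.
Qed.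

End Svd.

(** * Von Neumann's trace inequality *)

Section Majorization.
Variable R : realType.

(** Abel summation: a nonincreasing nonnegative sequence is a nonnegative
    combination of indicators of initial segments. *)
Lemma abel_sum_ge0 n (a c : 'I_n -> R) :
    (forall i, 0 <= a i) -> (forall i j : 'I_n, (i <= j)%N -> a j <= a i) ->
    (forall l, 0 <= \sum_(i < n | (i < l)%N) c i) ->
  0 <= \sum_i a i * c i.
Proof.
elim: n a c => [|n IHn] a c a0 aS cP; first by rewrite big_ord0.
pose z := a ord_max; pose W := @widen_ord n n.+1 (leqnSn n).
have -> : \sum_i a i * c i = \sum_(i < n) (a (W i) - z) * c (W i) + z * \sum_i c i.
  rewrite !big_ord_recr /= mulrDr addrA mulr_sumr -big_split /=; congr (_ + _).
  by apply: eq_bigr => i _; rewrite mulrBl subrK.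
apply: addr_ge0; last first.
  apply: mulr_ge0; first exact: a0.
  have := cP n.+1; congr (0 <= _).
  by apply: eq_bigl => i; rewrite ltn_ord.
apply: IHn => [i|i j ij|l].
- by rewrite subr_ge0; apply: aS; rewrite /= ltnW.
- by rewrite lerD2r; exact: aS.
- have [ln|nl] := leqP l n.
    have := cP l; rewrite big_mkcond big_ord_recr /= ltnNge ln addr0.
    by rewrite -big_mkcond.
  have := cP n; rewrite big_mkcond big_ord_recr /= ltnn addr0 => h.
  rewrite big_mkcond /=; congr (0 <= _): h; apply: eq_bigr => i _.
  by rewrite ltn_ord (ltn_trans (ltn_ord i) nl).
Qed.

(** The difference of both sides is bilinear in [a] and [b], so two Abel summations
    reduce the claim to indicators of initial segments.  There it says that the
    entries of [S] in an upper left block add up to at most the smaller of the two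
    sides of the block. *)
Lemma substochastic_le n (a b : 'I_n -> R) (S : 'I_n -> 'I_n -> R) :
    (forall i, 0 <= a i) -> (forall i j : 'I_n, (i <= j)%N -> a j <= a i) ->
    (forall i, 0 <= b i) -> (forall i j : 'I_n, (i <= j)%N -> b j <= b i) ->
    (forall i j, 0 <= S i j) ->
    (forall i, \sum_j S i j <= 1) -> (forall j, \sum_i S i j <= 1) ->
  \sum_i \sum_j a i * b j * S i j <= \sum_i a i * b i.
Proof.
move=> a0 aS b0 bS S0 Sr Sc; rewrite -subr_ge0 -sumrB.
pose D i j : R := (i == j)%:R - S i j.
rewrite (eq_bigr (fun i => a i * \sum_j b j * D i j)); last first.
  move=> i _; rewrite /D; under [in RHS]eq_bigr do rewrite mulrBr.
  rewrite sumrB mulrBr; congr (_ - _).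
    rewrite (bigD1 i) //= eqxx mulr1 big1 ?addr0 // => j ji.
    by rewrite eq_sym (negPf ji) mulr0.
  by rewrite mulr_sumr; under eq_bigr do rewrite -mulrA.
apply: abel_sum_ge0 => // l.
rewrite exchange_big /=; under eq_bigr do rewrite -mulr_sumr.
apply: abel_sum_ge0 => // l'.
rewrite exchange_big /=.
have partial (T : 'I_n -> 'I_n -> R) p p' : (p <= p')%N ->
    (forall i j, 0 <= T i j) -> (forall i, \sum_j T i j <= 1) ->
  0 <= \sum_(i < n | (i < p)%N) \sum_(j < n | (j < p')%N) ((i == j)%:R - T i j).
  move=> pp T0 T1; apply: sumr_ge0 => i ip; rewrite sumrB.
  rewrite (bigD1 i) ?(leq_trans ip) //= eqxx big1 ?addr0 => [|j /andP[_ ji]]; last first.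
    by rewrite eq_sym (negPf ji).
  rewrite subr_ge0; apply: le_trans (T1 i).
  by rewrite [leRHS](bigID (fun j : 'I_n => (j < p')%N)) /= lerDl sumr_ge0.
have [ll|ll] := leqP l l'; first exact: partial.
rewrite exchange_big /=; under eq_bigr do under eq_bigr do rewrite /D eq_sym.
by apply: (partial (fun i j => S j i)) => //; exact: ltnW.
Qed.

End Majorization.

Section TraceInequality.
Variables (R : realType) (k : field_kind).
Local Notation K := (base_field R k).
Local Notation "A ^H" := (A ^t (@sconj R k)) (at level 8, format "A ^H").
Local Notation "'[ A , B ]" := (fdot A B).
Variables m n : nat.
Local Notation r := (minn m n).
Local Notation wl := (widen_ord (geq_minl m n)).
Local Notation wr := (widen_ord (geq_minr m n)).
Local Notation rdiag := (@rect_diag R k m n).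
Implicit Types (A B W : 'M[K]_(m, n)) (U : 'M[K]_m) (V : 'M[K]_n) (a b w : 'rV[R]_r).

Lemma rect_diag_of (f : nat -> R) : rdiag (\row_i f i) = diag_of _ m n f.
Proof.
apply/matrixP => i j; rewrite summxE !mxE.
have [ij|ij] := eqVneq (i : nat) j; last first.
  rewrite big1 // => l _; rewrite !mxE; case: eqP => [il|_]; last by rewrite mulr0.
  case: eqP => [jl|_]; last by rewrite mulr0.
  by case/eqP: ij; rewrite il jl.
have lr : (i < r)%N by rewrite leq_min ltn_ord ij ltn_ord.
rewrite (bigD1 (Ordinal lr)) //= !mxE big1 ?addr0; last first.
  move=> l li; rewrite !mxE (negPf (_ : i != wl l)) ?mulr0 //.
  by apply: contra li => /eqP il; apply/eqP/val_inj; rewrite /= il.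
have -> : i == wl (Ordinal lr) by apply/eqP/val_inj.
have -> : j == wr (Ordinal lr) by apply/eqP/val_inj; rewrite /= ij.
by rewrite mulr1.
Qed.

Lemma is_svd_svd A : is_svd A (svd A).
Proof.
suff [USV ASV] : exists USV, is_svd A USV.
  by rewrite /svd; case: xgetP => [x _ //|/(_ USV)].
have [b b0 bP] := mx_bounded A.
have [||U [V [f [UU VV E fP fS]]]] := @svd_ind R k m n A (Num.sqrt b).
- exact: sqrtr_ge0.
- by move=> w; rewrite sqr_sqrtr.
exists (U, \row_i f i, V); split=> //= [i|i j ij|].
- by rewrite mxE; case/andP: (fP i).
- by rewrite !mxE; exact: fS.
- rewrite rect_diag_of -E !mulmxA unitary_mulmxC // mul1mx.
  by rewrite -mulmxA unitary_mulmxC // mulmx1.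
Qed.

Lemma fdot_rect_diag a X :
  '[rdiag a, X] = \sum_l a 0 l * real_part (X (wl l) (wr l)).
Proof.
rewrite /fdot /rdot linear_sumlz real_part_sum; apply: eq_bigr => l _.
rewrite -/(rdot _ _ _) rdotZl -/(fdot _ _) fdotE; congr (_ * _).
rewrite (bigD1 (wl l)) //= (bigD1 (wr l)) //= !mxE !eqxx mul1r real_part_conj.
rewrite big1 ?addr0 => [|j jl]; last by rewrite mxE (negPf jl) andbF mul0r real_part0.
rewrite big1 ?addr0 // => i il; rewrite big1 // => j _.
by rewrite mxE (negPf il) mul0r real_part0.
Qed.

Lemma fdot_svd U V U' V' a b :
  '[U *m rdiag a *m V^H, U' *m rdiag b *m V'^H] =
  \sum_l \sum_j a 0 l * b 0 j *
     real_part ((U^H *m U') (wl l) (wl j) * sconj ((V^H *m V') (wr l) (wr j))).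
Proof.
rewrite fdot_mulr ctrmxK -mulmxA fdot_mull mulmxA fdot_rect_diag.
apply: eq_bigr => l _.
under [RHS]eq_bigr do rewrite -mulrA; rewrite -mulr_sumr; congr (_ * _).
rewrite (_ : U^H *m _ = (U^H *m U') *m rdiag b *m (V^H *m V')^H); last first.
  by rewrite ctrmxM ctrmxK !mulmxA.
move: (U^H *m U') (V^H *m V') => X Y.
rewrite /rect_diag mulmx_sumr mulmx_suml summxE real_part_sum.
apply: eq_bigr => j _; rewrite -scalemxAr -scalemxAl mxE real_partZ.
rewrite -(mul_delta_mx (0 : 'I_1)) mulmxA -colE -mulmxA -rowE.
by rewrite mxE big_ord1 !mxE.
Qed.

Lemma fdot_svd_diag U V a b : U^H *m U = 1%:M -> V^H *m V = 1%:M ->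
  '[U *m rdiag a *m V^H, U *m rdiag b *m V^H] = \sum_l a 0 l * b 0 l.
Proof.
move=> UU VV; rewrite fdot_svd UU VV; apply: eq_bigr => l _.
rewrite (bigD1 l) //= !mxE !eqxx (rmorph1 sconj) mulr1 big1 ?addr0.
  by rewrite -[1](rmorph1 of_real) of_realK mulr1.
move=> j jl; rewrite !mxE (negPf (_ : wl l != wl j)) ?mul0r ?real_part0 ?mulr0 //.
by apply: contra jl => /eqP/(congr1 val) /= E; apply/eqP/val_inj.
Qed.

Lemma unitary_row_sum p (X : 'M[K]_p) i : X^H *m X = 1%:M ->
  \sum_j sqabs (X i j) = 1.
Proof.
move=> /unitary_mulmxC/matrixP/(_ i i); rewrite !mxE eqxx => E.
apply: (@of_real_inj R k); rewrite rmorph_sum rmorph1 -[RHS]E.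
by apply: eq_bigr => j _; rewrite !mxE sqabsE.
Qed.

Lemma sqabs_conj (x : K) : sqabs (sconj x) = sqabs x.
Proof. by rewrite /sqabs sconjK mulrC. Qed.

Lemma unitary_col_sum p (X : 'M[K]_p) j : X^H *m X = 1%:M ->
  \sum_i sqabs (X i j) = 1.
Proof.
move=> XX; rewrite -(@unitary_row_sum _ X^H j); last exact: unitaryV.
by apply: eq_bigr => i _; rewrite !mxE sqabs_conj.
Qed.

Lemma sum_widen_le p q (le_pq : (p <= q)%N) (F : 'I_q -> R) :
  (forall i, 0 <= F i) -> \sum_(i < p) F (widen_ord le_pq i) <= \sum_i F i.
Proof.
move=> F0; rewrite -big_ord_narrow [leRHS](bigID (fun i : 'I_q => (i < p)%N)) /=.
by rewrite lerDl sumr_ge0.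
Qed.

(** Von Neumann's trace inequality.  In coordinates, the product of [A] and [B]
    weights [a_l b_j] by products of entries of two unitary matrices; the
    arithmetic-geometric inequality bounds these by averages of squared moduli,
    which form a doubly substochastic matrix. *)
Lemma fdot_svd_le A B U a V U' b V' :
    is_svd A (U, a, V) -> is_svd B (U', b, V') ->
  '[A, B] <= \sum_l a 0 l * b 0 l.
Proof.
move=> [/= UU VV a0 aS ->] [/= UU' VV' b0 bS ->]; rewrite fdot_svd.
set X := U^H *m U'; set Y := V^H *m V'.
have XX : X^H *m X = 1%:M by apply: unitaryM => //; exact: unitaryV.
have YY : Y^H *m Y = 1%:M by apply: unitaryM => //; exact: unitaryV.
pose S l j := (sqabs (X (wl l) (wl j)) + sqabs (Y (wr l) (wr j))) / 2.
have half (x y : R) : x <= 1 -> y <= 1 -> (x + y) / 2 <= 1 by lra.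
apply: (@le_trans _ _ (\sum_l \sum_j a 0 l * b 0 j * S l j)).
  apply: ler_sum => l _; apply: ler_sum => j _.
  by apply: ler_wpM2l; [exact: mulr_ge0 | exact: real_part_mul_le].
apply: substochastic_le => // [l j|l|j].
- by rewrite divr_ge0 // addr_ge0 // sqabs_ge0.
- rewrite -mulr_suml big_split /=; apply: half.
    by rewrite -(unitary_row_sum (wl l) XX); apply: sum_widen_le => i; exact: sqabs_ge0.
  by rewrite -(unitary_row_sum (wr l) YY); apply: sum_widen_le => i; exact: sqabs_ge0.
- rewrite -mulr_suml big_split /=; apply: half.
    rewrite -(unitary_col_sum (wl j) XX).
    by apply: (sum_widen_le _ (F := fun i => sqabs (X i (wl j)))) => i; exact: sqabs_ge0.
  rewrite -(unitary_col_sum (wr j) YY).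
  by apply: (sum_widen_le _ (F := fun i => sqabs (Y i (wr j)))) => i; exact: sqabs_ge0.
Qed.

End TraceInequality.

(** * The scalar penalty and its proximal map *)

Section Penalty.
Variable R : realType.
Implicit Types tau q s t w c : R.

(** The contribution of one singular value to the rank regularizer plus the
    squared norm: linear up to [tau], quadratic beyond. *)
Definition convex_penalty tau s : R := tau ^+ 2 - Num.max (tau - s) 0 ^+ 2 + s ^+ 2.

Lemma convex_penalty_le tau s : s <= tau -> convex_penalty tau s = 2 * tau * s.
Proof. by move=> st; rewrite /convex_penalty max_l ?subr_ge0 //; ring. Qed.

Lemma convex_penalty_ge tau s : tau <= s -> convex_penalty tau s = tau ^+ 2 + s ^+ 2.
Proof. by move=> ts; rewrite /convex_penalty max_r ?subr_le0 //; ring. Qed.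

(** [2 * w] is a subgradient at [s] of [convex_penalty] on the half line.  The
    factor [2] matches the gradient of a squared norm. *)
Definition half_slope tau s w :=
  forall t, 0 <= t -> convex_penalty tau s + 2 * w * (t - s) <= convex_penalty tau t.

Lemma half_slope0 tau w : 0 < tau -> w <= tau -> half_slope tau 0 w.
Proof.
move=> tau0 wt t t0; rewrite convex_penalty_le; last exact: ltW.
have [tt|tt] := leP t tau; first by rewrite convex_penalty_le //; nra.
by rewrite convex_penalty_ge ?(ltW tt) //; have := sqr_ge0 (t - tau); nra.
Qed.

Lemma half_slope_lo tau s : 0 < tau -> s <= tau -> half_slope tau s tau.
Proof.
move=> tau0 st t t0; rewrite convex_penalty_le //.
have [tt|tt] := leP t tau; first by rewrite convex_penalty_le //; nra.
by rewrite convex_penalty_ge ?(ltW tt) //; have := sqr_ge0 (t - tau); nra.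
Qed.

Lemma half_slope_hi tau s : 0 < tau -> tau <= s -> half_slope tau s s.
Proof.
move=> tau0 st t t0; rewrite convex_penalty_ge //.
have [tt|tt] := leP t tau.
  rewrite convex_penalty_le //.
  have : 0 <= (s - tau) * (s + tau - 2 * t) by apply: mulr_ge0; lra.
  lra.
by rewrite convex_penalty_ge ?(ltW tt) //; have := sqr_ge0 (t - s); lra.
Qed.

Lemma half_slope_max tau s : 0 < tau -> half_slope tau s (Num.max tau s).
Proof.
by move=> tau0; case: (leP tau s) => [|/ltW]; [exact: half_slope_hi | exact: half_slope_lo].
Qed.

(** Up to scaling, the proximal map of [convex_penalty], for which [s_fun] is the
    complementary map: [c = s_fun c + (q - 1) * prox_fun c], where [s_fun c] is a
    half slope at [prox_fun c]. *)
Definition prox_fun tau q c : R := (c - s_fun tau q c) / (q - 1).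

Variant s_fun_spec tau q c : R -> R -> Prop :=
 | SFunSmall of c <= tau : s_fun_spec tau q c c 0
 | SFunMid of tau <= c & c <= q * tau : s_fun_spec tau q c tau ((c - tau) / (q - 1))
 | SFunLarge of q * tau <= c : s_fun_spec tau q c (c / q) (c / q).

Lemma s_funP tau q c : 0 < tau -> 1 < q -> 0 <= c ->
  s_fun_spec tau q c (s_fun tau q c) (prox_fun tau q c).
Proof.
move=> tau0 q1 c0; have q0 : 0 < q by lra.
rewrite /prox_fun /s_fun; have [ct|tc] := leP c tau.
  rewrite max_l; last by rewrite ler_pdivrMr //; nra.
  by rewrite subrr mul0r; exact: SFunSmall.
have [cq|qc] := leP (c / q) tau.
  by apply: SFunMid; [exact: ltW | rewrite mulrC -ler_pdivrMr].
have -> : (c - c / q) / (q - 1) = c / q by field; lra.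
by apply: SFunLarge; rewrite mulrC -ler_pdivlMr // ltW.
Qed.

Lemma half_slope_s_fun tau q c : 0 < tau -> 1 < q -> 0 <= c ->
  half_slope tau (prox_fun tau q c) (s_fun tau q c).
Proof.
move=> tau0 q1 c0; case: (s_funP tau0 q1 c0) => [ct|tc cq|qc].
- exact: half_slope0.
- by apply: half_slope_lo => //; rewrite ler_pdivrMr; nra.
- by apply: half_slope_hi => //; rewrite ler_pdivlMr 1?mulrC //; lra.
Qed.

Lemma s_fun_ge0 tau q c : 0 < tau -> 1 < q -> 0 <= c -> 0 <= s_fun tau q c.
Proof.
move=> tau0 q1 c0; case: (s_funP tau0 q1 c0) => // *; first exact: ltW.
by rewrite divr_ge0 //; lra.
Qed.

Lemma prox_fun_ge0 tau q c : 0 < tau -> 1 < q -> 0 <= c -> 0 <= prox_fun tau q c.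
Proof.
move=> tau0 q1 c0; case: (s_funP tau0 q1 c0) => // *; rewrite divr_ge0 //; lra.
Qed.

Lemma s_fun_homo tau q c d : 1 < q -> c <= d -> s_fun tau q c <= s_fun tau q d.
Proof.
move=> q1 cd; rewrite /s_fun ge_max !le_max; apply/andP; split.
  by rewrite le_min !ge_min cd lexx !orbT.
by rewrite ler_pM2r ?cd ?orbT // invr_gt0; lra.
Qed.

Lemma prox_fun_homo tau q c d : 0 < tau -> 1 < q -> 0 <= c -> c <= d ->
  prox_fun tau q c <= prox_fun tau q d.
Proof.
move=> tau0 q1 c0 cd; have q0 : 0 < q by lra.
have p0 := prox_fun_ge0 tau0 q1 (le_trans c0 cd).
have q10 : 0 < q - 1 by lra.
case: (s_funP tau0 q1 c0) => // [tc cq|qc]; move: p0;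
  case: (s_funP tau0 q1 (le_trans c0 cd)) => // [dt|td dq|qd] _.
- have -> : c = tau by lra.
  by rewrite subrr mul0r.
- by rewrite ler_pM2r ?invr_gt0 //; lra.
- rewrite ler_pdivrMr //; have : tau <= d / q by rewrite ler_pdivlMr // mulrC.
  rewrite -subr_ge0 -(pmulr_lge0 _ q10); lra.
- have : 0 < (q - 1) * tau by exact: mulr_gt0.
  lra.
- have -> : d = c by lra.
  have -> : c = q * tau by lra.
  rewrite le_eqVlt; apply/orP; left; apply/eqP; field; lra.
- by rewrite ler_pM2r ?invr_gt0.
Qed.

End Penalty.

(** * Subgradients of the penalty on matrices *)

Section MatrixPenalty.
Variables (R : realType) (k : field_kind) (m n : nat).
Local Notation K := (base_field R k).
Local Notation "A ^H" := (A ^t (@sconj R k)) (at level 8, format "A ^H").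
Local Notation "'[ A , B ]" := (fdot A B).
Local Notation rdiag := (@rect_diag R k m n).
Implicit Types (A B C W : 'M[K]_(m, n)) (tau q : R).

Definition mx_penalty tau A : R := rank_regularizer tau A + '[A, A].

Definition half_subgradient tau A W :=
  forall B, mx_penalty tau A + 2 * '[W, B - A] <= mx_penalty tau B.

Lemma mx_penalty_svd tau A :
  mx_penalty tau A = \sum_i convex_penalty tau (singular_value A i).
Proof.
rewrite big_split /= /mx_penalty; congr (_ + _).
have [UU VV _ _ AE] := is_svd_svd A.
by rewrite {1 2}AE fdot_svd_diag //; apply: eq_bigr => i _; rewrite -expr2.
Qed.

(** Since [A] and [W] share their singular vectors, their inner product is the sum
    of the products of singular values, while that of [W] and [B] is bounded by
    the trace inequality.  What remains is the scalar slope inequality at each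
    index. *)
Lemma penalty_sum_le tau A B W U a w V U' b V' :
    is_svd A (U, a, V) -> is_svd W (U, w, V) -> is_svd B (U', b, V') ->
    (forall i, half_slope tau (a 0 i) (w 0 i)) ->
  \sum_i convex_penalty tau (a 0 i) + 2 * '[W, B - A] <=
    \sum_i convex_penalty tau (b 0 i).
Proof.
move=> sA sW sB slope; rewrite {1}/fdot rdotBr -!/(fdot _ _).
have WA : '[W, A] = \sum_i w 0 i * a 0 i.
  by case: sA sW => [/= UU VV _ _ ->] [/= _ _ _ _ ->]; exact: fdot_svd_diag.
have WB := fdot_svd_le sW sB.
apply: (@le_trans _ _ (\sum_i (convex_penalty tau (a 0 i) + 2 * w 0 i * (b 0 i - a 0 i)))).
  rewrite [leRHS]big_split /= lerD2l; under eq_bigr do rewrite -mulrA.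
  rewrite -mulr_sumr ler_pM2l ?ltr0n // WA.
  under [leRHS]eq_bigr do rewrite mulrBr.
  by rewrite sumrB lerD2r.
by apply: ler_sum => i _; apply: slope; case: sB.
Qed.

Lemma is_svd_of A U a V f :
    is_svd A (U, a, V) -> (forall i, 0 <= f (a 0 i)) ->
    (forall s t, 0 <= s -> s <= t -> f s <= f t) ->
  is_svd (U *m rdiag (\row_i f (a 0 i)) *m V^H) (U, \row_i f (a 0 i), V).
Proof.
move=> [/= UU VV a0 aS _] f0 fS; split=> //= [i|i j ij]; rewrite !mxE //.
by apply: fS => //; exact: aS.
Qed.

Lemma is_svd_max tau A U a V : 0 < tau -> is_svd A (U, a, V) ->
  is_svd (U *m rdiag (\row_i Num.max tau (a 0 i)) *m V^H)
    (U, \row_i Num.max tau (a 0 i), V).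
Proof.
move=> tau0 sA; apply: (is_svd_of sA) => [i|s t _ st]; first by rewrite le_max ltW.
by rewrite ge_max !le_max lexx st orbT.
Qed.

(** The value does not depend on the decomposition.  Two decompositions of the
    same matrix can be compared in both directions by [penalty_sum_le], using a
    half slope at each singular value. *)
Lemma mx_penaltyE tau A U a V : 0 < tau -> is_svd A (U, a, V) ->
  mx_penalty tau A = \sum_i convex_penalty tau (a 0 i).
Proof.
move=> tau0; have le U1 a1 V1 U2 a2 V2 : is_svd A (U1, a1, V1) -> is_svd A (U2, a2, V2) ->
    \sum_i convex_penalty tau (a1 0 i) <= \sum_i convex_penalty tau (a2 0 i).
  move=> s1 s2; have := @penalty_sum_le tau _ _ _ _ _ _ _ _ _ _ s1 (is_svd_max tau0 s1) s2.
  rewrite subrr [fdot _ 0]rdot0r mulr0 addr0; apply=> i.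
  by rewrite mxE; exact: half_slope_max.
move=> sA; rewrite mx_penalty_svd; apply/eqP; rewrite eq_le.
have := is_svd_svd A; rewrite /singular_value; case: (svd A) => [[U' a'] V'] sA' /=.
by rewrite (le _ _ _ _ _ _ sA sA') (le _ _ _ _ _ _ sA' sA).
Qed.

Lemma half_subgradient_svd tau A W U a w V : 0 < tau ->
    is_svd A (U, a, V) -> is_svd W (U, w, V) ->
    (forall i, half_slope tau (a 0 i) (w 0 i)) ->
  half_subgradient tau A W.
Proof.
move=> tau0 sA sW slope B; have := is_svd_svd B.
case: (svd B) => [[U' b] V'] sB.
by rewrite (mx_penaltyE tau0 sA) (mx_penaltyE tau0 sB); exact: (penalty_sum_le sA sW sB slope).
Qed.

Lemma half_subgradient_exists tau A : 0 < tau -> exists W, half_subgradient tau A W.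
Proof.
move=> tau0; have := is_svd_svd A; case: (svd A) => [[U a] V] sA.
exists (U *m rdiag (\row_i Num.max tau (a 0 i)) *m V^H).
apply: (half_subgradient_svd tau0 sA).
- exact: (is_svd_max tau0 sA).
- by move=> i; rewrite mxE; exact: half_slope_max.
Qed.

(** A function with a subgradient at every point is convex: average the two
    subgradient inequalities at the intermediate point. *)
Lemma mx_penalty_convex tau A B (t : R) : 0 < tau -> 0 <= t <= 1 ->
  mx_penalty tau (of_real t *: A + of_real (1 - t) *: B) <=
    t * mx_penalty tau A + (1 - t) * mx_penalty tau B.
Proof.
move=> tau0 /andP[t0 t1]; set C := _ + _.
have [W CW] := half_subgradient_exists C tau0.
have WC : '[W, C] = t * '[W, A] + (1 - t) * '[W, B].
  by rewrite {1}/fdot rdotDr !rdotZr.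
have := CW A; have := CW B; rewrite /fdot !rdotBr -!/(fdot _ _) WC.
move: '[W, A] '[W, B] => wa wb hB hA.
have := ler_wpM2l t0 hA; have t1' : 0 <= 1 - t by lra.
have := ler_wpM2l t1' hB; lra.
Qed.

Lemma sv_calculus_split tau q C : q != 1 ->
  C = sv_calculus (s_fun tau q) C + of_real (q - 1) *: sv_calculus (prox_fun tau q) C.
Proof.
move=> q1; have [_ _ _ _ CE] := is_svd_svd C.
rewrite {1}CE /sv_calculus scalemxAl scalemxAr -mulmxDl -mulmxDr.
congr (_ *m _ *m _); rewrite /rect_diag scaler_sumr -big_split /=.
apply: eq_bigr => i _; rewrite scalerA -scalerDl -rmorphM -rmorphD !mxE.
congr (of_real _ *: _); rewrite /singular_value /prox_fun.
by field; rewrite subr_eq0.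
Qed.

Lemma half_subgradient_calculus tau q C : 0 < tau -> 1 < q ->
  half_subgradient tau (sv_calculus (prox_fun tau q) C) (sv_calculus (s_fun tau q) C).
Proof.
move=> tau0 q1; have := is_svd_svd C; rewrite /sv_calculus /singular_value.
case: (svd C) => [[U c] V] sC /=; have c0 : forall i, 0 <= c 0 i by case: sC.
apply: (half_subgradient_svd tau0).
- apply: (is_svd_of sC) => [i|s t s0 st]; first exact: prox_fun_ge0.
  exact: prox_fun_homo.
- apply: (is_svd_of sC) => [i|s t s0 st]; first exact: s_fun_ge0.
  exact: s_fun_homo.
- by move=> i; rewrite !mxE; exact: half_slope_s_fun.
Qed.

(** Any [C] splits as [S + (q - 1) P] with [S] a half subgradient at [P].  Such a
    splitting is unique because the subdifferential is monotone: for two of them,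
    [S - S' = - (q - 1) (P - P')], while [S - S'] and [P - P'] have a nonnegative
    inner product. *)
Lemma half_subgradient_fixed tau q A W : 0 < tau -> 1 < q ->
  half_subgradient tau A W <->
  W = sv_calculus (s_fun tau q) (W + of_real (q - 1) *: A).
Proof.
move=> tau0 q1; set C := W + _.
have q10 : q - 1 != 0 by rewrite subr_eq0 gt_eqF.
have qK : of_real (q - 1) != 0 :> K by rewrite fmorph_eq0.
have CE := sv_calculus_split tau C (negbT (gt_eqF q1)).
have := half_subgradient_calculus C tau0 q1.
move: (sv_calculus (s_fun tau q) C) (sv_calculus (prox_fun tau q) C) CE.
move=> S P CE PS; split=> [AW|WS].
- have AP : A - P = 0.
    apply: (@rdot_eq0 _ _ _ (@frobenius R k m n)); rewrite -/(fdot _ _).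
    have WS : W - S = of_real (1 - q) *: (A - P).
      have -> : W = S + of_real (q - 1) *: P - of_real (q - 1) *: A by rewrite -CE addrK.
      rewrite (_ : 1 - q = - (q - 1)); last by rewrite opprB.
      by rewrite rmorphN scaleNr scalerBr opprB addrAC [S + _]addrC addrK.
    have mono : 0 <= '[W - S, A - P].
      have := AW P; have := PS A; rewrite /fdot !(rdotBl, rdotBr) -!/(fdot _ _); lra.
    move: mono; rewrite WS /fdot rdotZl -/(fdot _ _) => mono.
    apply/eqP; rewrite eq_le rdot_ge0 andbT leNgt; apply/negP => AP0.
    have : 0 < (q - 1) * '[A - P, A - P] by apply: mulr_gt0 => //; rewrite subr_gt0.
    lra.
  move/eqP: AP; rewrite subr_eq0 => /eqP AP.
  by move: CE; rewrite /C AP => /addIr.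
- suff -> : A = P by rewrite WS.
  move: CE; rewrite /C WS => /addrI/(congr1 (fun X => (of_real (q - 1))^-1 *: X)).
  by rewrite !scalerA mulVf // !scale1r.
Qed.

End MatrixPenalty.

(** * Extending a subgradient from a subspace *)

Section HahnBanach.
Variables (R : realType) (k : field_kind).
Local Notation K := (base_field R k).

Section ConvexGraph.
Variables (U : lmodType K) (p : U -> R).
Hypothesis p_convex : forall (a b : R) u v, 0 <= a -> 0 <= b -> a + b = 1 ->
  p (of_real a *: u + of_real b *: v) <= a * p u + b * p v.

(** Pairs [(u, c)] with [G u c] stand for points where a partial affine functional
    takes the value [c].  Only convexity of the set of pairs is required, so no
    subspace has to be enlarged nor any quotient taken when a direction is
    added. *)
Definition convex_graph (G : U -> R -> Prop) :=
  forall (a b : R) u v c d, 0 <= a -> 0 <= b -> a + b = 1 -> G u c -> G v d ->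
    G (of_real a *: u + of_real b *: v) (a * c + b * d).

(** The slope [w] must dominate all difference quotients in the direction [- e] and
    be dominated by those in the direction [e].  Convexity of [p] and [G] makes each
    of the former at most each of the latter, hence the supremum of the former is
    a valid choice. *)
Lemma hahn_banach_step (G : U -> R -> Prop) (e : U) :
    convex_graph G -> (forall u c, G u c -> c <= p u) ->
  exists w, forall u c (x : R), G u c -> c + w * x <= p (u + of_real x *: e).
Proof.
move=> Gconv Gp; have [[u0 [c0 Guc0]]|noG] := pselect (exists u c, G u c); last first.
  by exists 0 => u c x Guc; case: noG; exists u, c.
pose slopes : set R :=
  [set s | exists u c t, [/\ G u c, 0 < t & s = (c - p (u - of_real t *: e)) / t]].
have upper v d t : G v d -> 0 < t -> ubound slopes ((p (v + of_real t *: e) - d) / t).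
  move=> Gvd t0 _ [u [c [s [Guc s0 ->]]]].
  rewrite ler_pdivrMr // mulrAC ler_pdivlMr //.
  have ts : 0 < t + s by exact: addr_gt0.
  pose a := t / (t + s); pose b := s / (t + s).
  have a0 : 0 <= a by rewrite divr_ge0 // ltW.
  have b0 : 0 <= b by rewrite divr_ge0 // ltW.
  have ab : a + b = 1 by rewrite -mulrDl divff // gt_eqF.
  have aE : a * (t + s) = t by rewrite divfK // gt_eqF.
  have bE : b * (t + s) = s by rewrite divfK // gt_eqF.
  have := p_convex (u - of_real s *: e) (v + of_real t *: e) a0 b0 ab.
  have -> : of_real a *: (u - of_real s *: e) + of_real b *: (v + of_real t *: e) =
            of_real a *: u + of_real b *: v.
    rewrite scalerBr scalerDr !scalerA -!rmorphM addrACA -[RHS]addr0; congr (_ + _).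
    rewrite (_ : a * s = b * t) ?addNr // /a /b; field; exact: lt0r_neq0.
  have := Gp _ _ (Gconv _ _ _ _ _ _ a0 b0 ab Guc Gvd).
  clearbody a b; move: (p _) (p _) (p _) => P P1 P2 h1 h2.
  have := ler_wpM2r (ltW ts) (le_trans h1 h2).
  rewrite !mulrDl -!(mulrAC _ (t + s)) aE bE; lra.
have sup_slopes : has_sup slopes.
  split; first by exists ((c0 - p (u0 - of_real 1 *: e)) / 1); exists u0, c0, 1.
  by exists ((p (u0 + of_real 1 *: e) - c0) / 1); exact: upper.
exists (sup slopes) => u c x Guc.
have [x0|x0|->] := ltrgt0P x; last by rewrite mulr0 addr0 rmorph0 scale0r addr0; exact: Gp.
- rewrite -lerBrDl -ler_pdivlMr //; apply: ge_sup; first exact: sup_slopes.1.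
  exact: upper.
- have nx : 0 < - x by rewrite oppr_gt0.
  have : slopes ((c - p (u - of_real (- x) *: e)) / - x) by exists u, c, (- x).
  move=> /(sup_upper_bound sup_slopes); rewrite ler_pdivrMr //.
  by rewrite rmorphN scaleNr opprK; lra.
Qed.

(** The conclusion for a list of directions produces a convex graph again, which
    makes the one-dimensional step iterable. *)
Lemma hahn_banach_family (I : eqType) (e : I -> U) (s : seq I) (G : U -> R -> Prop) :
    uniq s -> convex_graph G -> (forall u c, G u c -> c <= p u) ->
  exists w : I -> R, forall u c (x : I -> R), G u c ->
    c + \sum_(i <- s) w i * x i <= p (u + \sum_(i <- s) of_real (x i) *: e i).
Proof.
elim: s => [|j s IHs] /= us Gconv Gp.
  by exists (fun=> 0) => u c x Guc; rewrite !big_nil !addr0; exact: Gp.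
case/andP: us => js us; have [w wP] := IHs us Gconv Gp.
pose G' u c := exists v d (x : I -> R), [/\ G v d,
  u = v + \sum_(i <- s) of_real (x i) *: e i & c = d + \sum_(i <- s) w i * x i].
have [|u c [v [d [x [Gvd -> ->]]]]|a aP] := @hahn_banach_step G' (e j).
- move=> a b _ _ _ _ a0 b0 ab [u [c [x [Guc -> ->]]]] [v [d [y [Gvd -> ->]]]].
  exists (of_real a *: u + of_real b *: v), (a * c + b * d), (fun i => a * x i + b * y i).
  split; first exact: Gconv.
    rewrite !scalerDr addrACA !scaler_sumr -big_split /=; congr (_ + _).
    by apply: eq_bigr => i _; rewrite !scalerA -!rmorphM rmorphD scalerDl.
  rewrite !mulrDr addrACA !mulr_sumr -big_split /=; congr (_ + _).
  by apply: eq_bigr => i _; ring.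
- exact: wP.
exists (fun i => if i == j then a else w i) => u c x Guc.
have -> : \sum_(i <- j :: s) (if i == j then a else w i) * x i =
          \sum_(i <- s) w i * x i + a * x j.
  rewrite big_cons eqxx addrC; congr (_ + _); apply: eq_big_seq => i is_.
  by rewrite (negPf (_ : i != j)) //; apply: contraNneq js => <-.
rewrite big_cons [of_real (x j) *: _ + _]addrC !addrA; apply: aP.
by exists u, c, x.
Qed.

End ConvexGraph.

Lemma scalar_frame : exists z : K, forall x : K,
  x = of_real (real_part x) + of_real (real_part (x * sconj z)) * z.
Proof.
case: k => /=; first by exists 0 => x /=; rewrite mulr0 addr0.
exists 'i%C => -[a b]; apply/eqP; rewrite eq_complex /=.
by apply/andP; split; apply/eqP; ring.
Qed.

(** A family playing the role of a real orthonormal basis.  Over the real numbers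
    half of its members vanish, which keeps the two cases uniform. *)
Lemma mx_frame m n : exists e : 'I_m * 'I_n * bool -> 'M[K]_(m, n),
  forall B, B = \sum_i of_real (fdot B (e i)) *: e i.
Proof.
have [z zP] := scalar_frame.
pose c (b : bool) : K := if b then z else 1.
exists (fun i => c i.2 *: delta_mx i.1.1 i.1.2) => B.
have dotE i j b : fdot B (c b *: delta_mx i j) = real_part (B i j * sconj (c b)).
  rewrite fdotE (bigD1 i) //= (bigD1 j) //= !mxE !eqxx mulr1.
  rewrite big1 ?addr0 => [|j' jj]; last first.
    by rewrite !mxE (negPf jj) andbF mulr0 rmorph0 mulr0 real_part0.
  rewrite big1 ?addr0 // => i' ii; rewrite big1 // => j' _.
  by rewrite !mxE (negPf ii) mulr0 rmorph0 mulr0 real_part0.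
rewrite {1}(matrix_sum_delta B) pair_bigA /=.
rewrite -(pair_bigA _ (fun (ij : 'I_m * 'I_n) b =>
  of_real (fdot B (c b *: delta_mx ij.1 ij.2)) *: (c b *: delta_mx ij.1 ij.2))) /=.
apply: eq_bigr => -[i j] _; rewrite big_bool !dotE /= !scalerA -scalerDl.
by congr (_ *: _); rewrite addrC rmorph1 !mulr1; exact: zP.
Qed.

(** The functional given by [Y] on [H] extends to all matrices below [p].  Its
    values on the frame define [W]; comparing at [A + B] and [A - B] with [B] in [H]
    shows that [W] and [Y] agree on [H]. *)
Lemma subgradient_extension m n (H : {vspace 'M[K]_(m, n)}) (p : 'M[K]_(m, n) -> R) A Y :
    (forall (a b : R) u v, 0 <= a -> 0 <= b -> a + b = 1 ->
      p (of_real a *: u + of_real b *: v) <= a * p u + b * p v) ->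
    A \in H -> (forall B, B \in H -> p A + fdot Y (B - A) <= p B) ->
  exists2 W, forall B, p A + fdot W (B - A) <= p B &
             forall B, B \in H -> fdot W B = fdot Y B.
Proof.
move=> p_convex AH sub; have [e eP] := mx_frame m n.
pose G u c := u \in H /\ c = p A + fdot Y (u - A).
have [a b u v c d a0 b0 ab [uH ->] [vH ->]|u c [uH ->]|w wP] :=
    @hahn_banach_family _ _ p_convex _ e (index_enum _) G (index_enum_uniq _).
- split; first by rewrite memvD ?memvZ.
  rewrite /fdot !(rdotBr, rdotDr, rdotZr).
  rewrite (_ : b = 1 - a); last by rewrite -ab addrAC subrr add0r.
  ring.
- exact: sub.
pose W := \sum_i of_real (w i) *: e i.
have WE B : fdot W B = \sum_i w i * fdot B (e i).
  rewrite /fdot /rdot linear_sumlz real_part_sum; apply: eq_bigr => i _.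
  by apply: etrans (rdotZl _ _ _ _) _; congr (_ * _); exact: rdotC.
have YW B : B \in H -> fdot Y B <= fdot W B.
  move=> BH; have := wP (A + B) _ (fun i => fdot (- B) (e i)) (conj (memvD AH BH) erefl).
  rewrite -WE -eP addrK [A + B - A]addrC addKr.
  by rewrite /fdot rdotNr -!/(fdot _ _); lra.
exists W => [B|B BH].
  have := wP A _ (fun i => fdot (B - A) (e i)) (conj AH erefl).
  by rewrite -WE -eP subrr [fdot _ 0]rdot0r addr0 [A + _]addrC subrK.
apply/eqP; rewrite eq_le YW // andbT.
have := YW (- B); rewrite memvN => /(_ BH).
by rewrite /fdot !rdotNr lerN2.
Qed.

End HahnBanach.

(** * The fixed point operator and the objective *)

(** Test both expansions on [t w], where [w] is the difference of the gradients:
    [t |w|^2] must be negligible compared to [t |w|] as [t] tends to [0]. *)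
Lemma is_gradient_unique (R : realType) (k : field_kind)
    (U : vectType (base_field R k)) (dot : {dot U for @sconj R k}) (f : U -> R) u g g' :
  is_gradient dot f u g -> is_gradient dot f u g' -> g = g'.
Proof.
move=> fg fg'; apply/eqP; rewrite -subr_eq0; apply/negPn/negP => w0.
set w := g - g' in w0; have N0 := rdot_gt0 dot w0; set N := rdot dot w w in N0.
pose n := Num.sqrt N; have n0 : 0 < n by rewrite sqrtr_gt0.
have nn : n * n = N by rewrite -expr2 sqr_sqrtr // ltW.
have e0 : 0 < n / 4 by rewrite divr_gt0.
have [d d0 dP] := fg _ e0; have [d' d'0 d'P] := fg' _ e0.
pose t := Num.min d d' / (2 * n).
have dd0 : 0 < Num.min d d' by rewrite lt_min d0.
have t0 : 0 < t by rewrite divr_gt0 // mulr_gt0.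
have tn : Num.sqrt (sqnorm dot (of_real t *: w)) = t * n.
  rewrite /sqnorm -/(rdot _ _ _) rdotZl rdotZr mulrA -expr2 sqrtrM ?sqr_ge0 //.
  by rewrite sqrtr_sqr gtr0_norm.
have tnE : t * n = Num.min d d' / 2 by rewrite /t; field; rewrite gt_eqF.
have td : t * n < d.
  by rewrite tnE; have : Num.min d d' <= d; [rewrite ge_min lexx | lra].
have td' : t * n < d'.
  by rewrite tnE; have : Num.min d d' <= d'; [rewrite ge_min lexx orbT | lra].
have := dP (of_real t *: w); have := d'P (of_real t *: w).
rewrite tn => /(_ td') h' /(_ td) h; move: h h'.
rewrite -!/(rdot _ _ _) !rdotZr !ler_norml => /andP[h1 h2] /andP[h3 h4].
have NE : N = rdot dot g w - rdot dot g' w by rewrite -rdotBl.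
have : t * N <= t * (N / 2).
  have -> : t * (N / 2) = 2 * (n / 4 * (t * n)) by rewrite -nn; field.
  rewrite NE mulrBr; lra.
by rewrite ler_pM2l //; lra.
Qed.

Lemma norm_sub_le (R : realType) (x y z : R) :
  0 <= x <= z -> 0 <= y <= z -> `|x - y| <= z.
Proof. by move=> /andP[x0 xz] /andP[y0 yz]; rewrite ler_norml; apply/andP; split; lra. Qed.

Section Orthoproj.
Variables (R : realType) (k : field_kind) (m n : nat).
Local Notation K := (base_field R k).
Variable H : {vspace 'M[K]_(m, n)}.

Lemma fdot_orthoproj W (B : subvs_of H) :
  fdot W (vsval B) = fdot (vsval (orthoproj H W)) (vsval B).
Proof.
rewrite -[W in LHS](orthoprojE H) {1}/fdot rdotDl [X in _ + X]rdotC.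
rewrite [X in _ + X](_ : _ = 0) ?addr0 //.
by rewrite /rdot /= orthoproj_complP ?subvsP // real_part0.
Qed.

Lemma orthoproj_eq W (Y : subvs_of H) :
  (forall B : subvs_of H, fdot W (vsval B) = fdot (vsval Y) (vsval B)) ->
  orthoproj H W = Y.
Proof.
move=> WY; apply/eqP; rewrite -subr_eq0; apply/eqP.
apply: (@rdot_eq0 _ _ _ (@sub_frobenius R k m n H)); rewrite rdotBl.
by apply/eqP; rewrite subr_eq0; apply/eqP; rewrite -[RHS]WY fdot_orthoproj.
Qed.

End Orthoproj.

Section Objective.
Variables (R : realType) (k : field_kind) (m n : nat).
Local Notation K := (base_field R k).
Variables (H : {vspace 'M[K]_(m, n)}) (V : vectType K) (dotV : {dot V for @sconj R k}).
Variables (T : 'Hom(subvs_of H, V)) (h : V) (tau q : R).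
Hypotheses (tau_gt0 : 0 < tau) (q_gt1 : 1 < q).
Local Notation dotH := (@sub_frobenius R k m n H).
Local Notation Ta := (adjoint_on dotV T).
Local Notation obj := (objective dotV T h tau q).
Local Notation phi := (@convex_part R k m n H tau).
Implicit Types (A B u v : subvs_of H).

Lemma rdot_adjoint u y : rdot dotH u (Ta y) = rdot dotV (T u) y.
Proof. by congr real_part; exact/esym/adjointP. Qed.

(** The projection to [H] that a fixed point [(W, A)] forces on [W]; its double is
    minus the gradient at [A] of the smooth part of the objective. *)
Definition dual_point A : subvs_of H :=
  of_real q *: (Ta (h - T A) + A) - of_real (q - 1) *: A.

Lemma smooth_part_expand A v :
  (obj \- phi) (A + v) - (obj \- phi) A - rdot dotH (- (of_real 2 *: dual_point A)) v =
  q * rdot dotV (T v) (T v) - rdot dotH v v.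
Proof.
have smoothE B : (obj \- phi) B = q * rdot dotV (T B - h) (T B - h) - rdot dotH B B.
  by rewrite /= /objective /convex_part opprD addrACA subrr add0r.
rewrite !smoothE rdotNl rdotZl /dual_point !(rdotBl, rdotZl, rdotDl).
rewrite (rdotC _ (Ta _) v) rdot_adjoint linearD /= !(rdotBr, rdotBl, rdotDl, rdotDr).
rewrite (rdotC _ v A) (rdotC dotV (T v) (T A)) (rdotC dotV h (T A)) (rdotC dotV h (T v)).
ring.
Qed.

Lemma smooth_part_gradient A :
    op_le dotH (Ta \o T)%VF \1%VF ->
  is_gradient dotH (obj \- phi) A (- (of_real 2 *: dual_point A)).
Proof.
have q0 : 0 < q := lt_trans ltr01 q_gt1.
move=> hT e e0; exists (e / q) => [|v vd]; first exact: divr_gt0.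
rewrite -/(rdot _ _ _) smooth_part_expand.
have Tv : rdot dotV (T v) (T v) <= rdot dotH v v.
  have := real_part_ge0 (hT v).
  rewrite add_lfunE opp_lfunE id_lfunE comp_lfunE /= -/(rdot _ _ _) rdotBl.
  by rewrite [X in _ - X]rdotC rdot_adjoint subr_ge0.
have vv : sqnorm dotH v = rdot dotH v v by [].
have v0 := rdot_ge0 dotH v; have Tv0 := rdot_ge0 dotV (T v).
rewrite vv in vd *; set N := Num.sqrt _ in vd *.
have NN : N * N = rdot dotH v v by rewrite -expr2 sqr_sqrtr.
have N0 : 0 <= N by exact: sqrtr_ge0.
have : N * N <= e / q * N by apply: ler_wpM2r => //; exact: ltW.
have -> : e / q * N = e * N / q by rewrite mulrAC.
rewrite NN ler_pdivlMr //.
rewrite [_ * q]mulrC => le_e; have qTv0 := mulr_ge0 (ltW q0) Tv0.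
have qTv := ler_wpM2l (ltW q0) Tv.
have vq : rdot dotH v v <= q * rdot dotH v v by rewrite ler_peMl // ltW.
apply: norm_sub_le; rewrite ?qTv0 ?v0 //=; first exact: le_trans qTv le_e.
exact: le_trans vq le_e.
Qed.

(** The smooth part has only one gradient, so being stationary fixes the
    subgradient of the convex part. *)
Lemma stationary_pointP A :
    op_le dotH (Ta \o T)%VF \1%VF ->
  stationary_point dotH obj phi A <->
  forall B, phi A + 2 * rdot dotH (dual_point A) (B - A) <= phi B.
Proof.
move=> hT; have grad := smooth_part_gradient A hT; split=> [[y ys [g gg yg]] B|sub].
  have /eqP := yg; rewrite addrC addr_eq0 (is_gradient_unique gg grad) eqr_opp => /eqP yE.
  by have := ys B; rewrite -yE -/(rdot _ _ _) rdotZl.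
exists (of_real 2 *: dual_point A) => [B|].
  by rewrite -/(rdot _ _ _) rdotZl; exact: sub.
by exists (- (of_real 2 *: dual_point A)) => //; rewrite subrr.
Qed.

(** The second component of the equation says that [W] projects to [dual_point A];
    the argument of the singular value map in the first component is then
    [W + (q - 1) A], and [half_subgradient_fixed] applies. *)
Lemma fixed_pointP W A :
  B_op dotV T h tau q (W, A) = (W, A) <->
  orthoproj H W = dual_point A /\ half_subgradient tau (vsval A) W.
Proof.
have q10 : q - 1 != 0 by rewrite subr_eq0 gt_eqF.
have qK : of_real (q - 1) != 0 :> K by rewrite fmorph_eq0.
rewrite (half_subgradient_fixed _ _ tau_gt0 q_gt1) /B_op /=.
set X := of_real q *: _.
have arg : orthoproj H W = dual_point A ->
    vsval X + orthoproj_compl H W = W + of_real (q - 1) *: vsval A.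
  move=> PW; rewrite -[W in RHS](orthoprojE H) PW /dual_point -/X.
  by rewrite linearB linearZ /= addrAC subrK.
split=> [E|[PW WE]].
  have [WE] := E; rewrite WE => AE.
  have PW : orthoproj H W = dual_point A.
    rewrite /dual_point -/X -[in RHS]AE scalerA -rmorphM mulfV // rmorph1 scale1r.
    by rewrite subKr.
  by split=> //; rewrite -arg.
rewrite arg // -WE PW /dual_point -/X subKr.
by rewrite scalerA -rmorphM mulVf // rmorph1 scale1r.
Qed.

(** Projecting a half subgradient to [H] gives one for the restriction to [H];
    conversely a subgradient of the restriction extends. *)
Lemma exists_fixed_pointP A :
  (exists W, B_op dotV T h tau q (W, A) = (W, A)) <->
  forall B, phi A + 2 * rdot dotH (dual_point A) (B - A) <= phi B.
Proof.
split=> [[W /fixed_pointP[PW AW]] B|sub].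
  by have := AW (vsval B); rewrite -linearB (fdot_orthoproj _ (B - A)) PW.
have convex_penalty_mx (a b : R) (u v : 'M[K]_(m, n)) : 0 <= a -> 0 <= b -> a + b = 1 ->
    mx_penalty tau (of_real a *: u + of_real b *: v) <=
      a * mx_penalty tau u + b * mx_penalty tau v.
  move=> a0 b0 ab; have -> : b = 1 - a by rewrite -ab addrAC subrr add0r.
  by apply: mx_penalty_convex => //; lra.
have [|W AW WY] := subgradient_extension (Y := of_real 2 *: vsval (dual_point A))
    convex_penalty_mx (subvsP A).
  move=> B BH; have := sub (vsproj H B).
  by rewrite /fdot rdotZl /rdot /= /sub_frobenius /convex_part linearB /= vsprojK.
(* [W] is a full subgradient, hence the factor one half. *)
exists (of_real 2^-1 *: W); apply/fixed_pointP; split.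
  apply: orthoproj_eq => B; rewrite {1}/fdot rdotZl -/(fdot _ _) WY ?subvsP //.
  by rewrite /fdot rdotZl mulrA mulVf ?mul1r.
move=> B; rewrite {1}/fdot rdotZl mulrA mulfV ?mul1r //; exact: AW.
Qed.

(** The objective is the convex matrix penalty plus a quadratic polynomial with
    second order part [q |T A|^2 - |A|^2]. *)
Lemma objective_conv (t : R) u v : 0 <= t <= 1 ->
  obj (of_real t *: u + of_real (1 - t) *: v) <=
    t * obj u + (1 - t) * obj v -
    t * (1 - t) * (q * rdot dotV (T (u - v)) (T (u - v)) - rdot dotH (u - v) (u - v)).
Proof.
move=> t01; have objE A :
    obj A = mx_penalty tau (vsval A) + q * rdot dotV (T A - h) (T A - h) - rdot dotH A A.
  by rewrite [rdot dotH A A](_ : _ = fdot (vsval A) (vsval A)) // addrAC addrK.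
have := mx_penalty_convex (vsval u) (vsval v) tau_gt0 t01.
rewrite !objE [T (_ + _)]linearD [vsval (_ + _)]linearD !linearZ /=.
have -> : of_real t *: T u + of_real (1 - t) *: T v - h =
          of_real t *: (T u - h) + of_real (1 - t) *: (T v - h).
  by rewrite !scalerBr addrACA -opprD -scalerDl -rmorphD [t + _]addrC subrK rmorph1 scale1r.
rewrite !sq_rdot_conv.
have -> : T u - h - (T v - h) = T (u - v) by rewrite opprB addrA subrK linearB.
rewrite -subr_ge0 => le_pen; rewrite -subr_ge0; move: le_pen; congr (0 <= _); ring.
Qed.

Lemma curvature_ge0 u : op_le dotH \1%VF (of_real q *: (Ta \o T)%VF) ->
  0 <= q * rdot dotV (T u) (T u) - rdot dotH u u.
Proof.
move=> /(_ u)/real_part_ge0.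
rewrite add_lfunE opp_lfunE id_lfunE scale_lfunE comp_lfunE /= -/(rdot _ _ _) rdotBl rdotZl.
by rewrite [rdot _ (Ta _) _]rdotC rdot_adjoint.
Qed.

Lemma curvature_gt0 u : op_lt dotH \1%VF (of_real q *: (Ta \o T)%VF) -> u != 0 ->
  0 < q * rdot dotV (T u) (T u) - rdot dotH u u.
Proof.
move=> hT /hT/real_part_gt0.
rewrite add_lfunE opp_lfunE id_lfunE scale_lfunE comp_lfunE /= -/(rdot _ _ _) rdotBl rdotZl.
by rewrite [rdot _ (Ta _) _]rdotC rdot_adjoint.
Qed.

End Objective.

Theorem theorem5p3 (R : realType) (k : field_kind) (M N : nat)
    (H : {vspace 'M[base_field R k]_(M, N)})
    (V : vectType (base_field R k)) (dotV : {dot V for @sconj R k})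
    (Mop : 'Hom(subvs_of H, V)) (h : V) (tau q : R)
    (htau : 0 < tau) (hq : 1 < q)
    (hM : op_le (@sub_frobenius R k M N H) (adjoint_on dotV Mop \o Mop)%VF \1%VF)
    (A0 : subvs_of H) :
  [/\ (exists W0 : 'M[base_field R k]_(M, N),
         B_op dotV Mop h tau q (W0, A0) = (W0, A0)) <->
       stationary_point (@sub_frobenius R k M N H)
         (objective dotV Mop h tau q) (@convex_part R k M N H tau) A0,
      op_le (@sub_frobenius R k M N H) \1%VF
        (of_real q *: (adjoint_on dotV Mop \o Mop)%VF) ->
      convex_on_space (objective dotV Mop h tau q)
    & op_lt (@sub_frobenius R k M N H) \1%VF
        (of_real q *: (adjoint_on dotV Mop \o Mop)%VF) ->
      strictly_convex_on_space (objective dotV Mop h tau q)].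
Proof.
set f := objective dotV Mop h tau q; split.
- by rewrite exists_fixed_pointP // stationary_pointP.
- move=> curv t u v _ _.
  change (f (of_real t%:num *: u + of_real (1 - t%:num) *: v) <=
    t%:num * f u + (1 - t%:num) * f v).
  have t01 : 0 <= t%:num <= 1 by rewrite ge0 le1.
  apply: le_trans (objective_conv dotV Mop h q htau u v t01) _.
  rewrite lerBlDr lerDl; apply: mulr_ge0; last exact: curvature_ge0.
  by case/andP: t01 => t0 t1; rewrite mulr_ge0 // subr_ge0.
- move=> curv t u v /andP[t0 t1] uv.
  change (f (of_real t%:num *: u + of_real (1 - t%:num) *: v) <
    t%:num * f u + (1 - t%:num) * f v).
  have t01 : 0 <= t%:num <= 1 by rewrite !ltW.
  apply: le_lt_trans (objective_conv dotV Mop h q htau u v t01) _.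
  rewrite ltrBlDr ltrDl; apply: mulr_gt0; first by rewrite mulr_gt0 // subr_gt0.
  by apply: curvature_gt0 => //; rewrite subr_eq0.
Qed.
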